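(* Let $m\ge 1$, $r\ge 0$ be integers and let $P\in LPDO_r$ have principal symbol $\underline\lambda$. Suppose $\underline\lambda_x\neq 0$ for each $x\in\mathbb R^m$. Then for every $g\in{}^*C^\infty(\mathbb R^m,\mathbb R)$ there exists $f\in{}^*C^\infty(\mathbb R^m,\mathbb R)$ with $${}^*j^\infty_{{}^*x}({}^*P(f))={}^*j^\infty_{{}^*x}\,g\qquad\text{for every }x\in\mathbb R^m .$$
   Context: Nonstandard setting: a fixed superstructure nonstandard extension $*$ that is polysaturated ($\kappa$-saturated with $\kappa$ larger than the cardinality of the standard superstructure). ${}^*C^\infty(\mathbb R^m,\mathbb R)$ is the set of internal *smooth functions ${}^*\mathbb R^m\to{}^*\mathbb R$. $LPDO_r$ is the space of linear partial differential operators $P=\sum_{|\alpha|\le r}f_\alpha\partial^\alpha$ with $f_\alpha\in C^\infty(\mathbb R^m,\mathbb R)$. The principal symbol at $x$ is the top-order part $\underline\lambda_x=\sum_{|\alpha|=r}f_\alpha(x)y_\alpha$, a linear form on $r$-jets at $x$, where $y_\alpha(j^r_xf)=\partial^\alpha f(x)$; thus $\underline\lambda_x\ne0$ means $f_\alpha(x)\neq0$ for some $\alpha$ with $|\alpha|=r$. For $f\in C^\infty(\mathbb R^m,\mathbb R)$, $j^k_xf$ is the $k$-jet of $f$ at $x$ (the collection of all partial derivatives of order $\le k$ at $x$). For $h\in{}^*C^\infty(\mathbb R^m,\mathbb R)$ and $\xi\in{}^*\mathbb R^m$, ${}^*j^\infty_\xi h$ is the internal sequence $({}^*j^k_\xi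 h)_{k\in{}^*\mathbb N_0}$, so equality of ${}^*j^\infty_\xi$ means that all *partial derivatives, of all orders in ${}^*\mathbb N_0$, agree at $\xi$. *)

(* Defs.v *)
From HB Require Import structures.
From mathcomp Require Import all_boot all_order all_algebra.
From mathcomp Require Import all_classical all_reals all_analysis.

Set Implicit Arguments.
Unset Strict Implicit.
Unset Printing Implicit Defensive.

Import Order.TTheory GRing.Theory Num.Theory.
Import numFieldNormedType.Exports.

Local Open Scope classical_set_scope.
Local Open Scope card_scope.
Local Open Scope ring_scope.

(* V_0 = the atoms, V_(n+1) = V_n together with all subsets of V_n *)
Fixpoint rank_le (T : Type) (elem : T -> T -> Prop) (atoms : set T) (n : nat) :
    set T :=
  if n is k.+1 then
    rank_le elem atoms k `|`
    [set a | ~ atoms a /\ forall c, elem c a -> rank_le elem atoms k c]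
  else atoms.

(* The superstructure over a base set X, given by its axioms; these determine it
   up to a unique isomorphism over X. *)
Record superstructure (X : Type) := Superstructure {
  carrier :> Type;
  elem : carrier -> carrier -> Prop;
  atom : X -> carrier;
  atom_inj : injective atom;
  elem_atom : forall a x, ~ elem a (atom x);
  elem_ext : forall a b, ~ range atom a -> ~ range atom b ->
    (forall c, elem c a <-> elem c b) -> a = b;
  finite_rank : forall a, exists n, rank_le elem (range atom) n a;
  comprehension : forall n (A : set carrier),
    A `<=` rank_le elem (range atom) n ->
    exists a, ~ range atom a /\ forall c, elem c a <-> A c
}.

Lemma vempty_subproof X (V : superstructure X) :
  exists a : V, ~ range (@atom X V) a /\ forall c, elem c a <-> set0 c.
Proof. by apply: (@comprehension X V 0%N set0). Qed.

HB.instance Definition _ X (V : superstructure X) := gen_eqMixin (carrier V).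
HB.instance Definition _ X (V : superstructure X) :=
  gen_choiceMixin (carrier V).
HB.instance Definition _ X (V : superstructure X) :=
  isPointed.Build (carrier V) (sval (cid (vempty_subproof V))).

Definition is_vset X (V : superstructure X) (a : V) : Prop :=
  ~ range (@atom X V) a.

(* the set { c | A c } as an element of V; meaningful when A has bounded rank *)
Definition vset X (V : superstructure X) (A : set V) : V :=
  get [set a : V | is_vset a /\ forall c, elem c a <-> A c].

Definition vbase X (V : superstructure X) : V := vset (range (@atom X V)).

Definition vpair X (V : superstructure X) (a b : V) : V :=
  vset [set vset [set a]; vset [set a; b]].

(* the graph { (dom t, val t) | t : T } *)
Definition vgraph X (V : superstructure X) (T : Type) (dom val : T -> V) : V :=
  vset (range (fun t => vpair (dom t) (val t))).

(* the value at a of the function with graph F *)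
Definition vapp X (V : superstructure X) (F a : V) : V :=
  get [set b : V | elem (vpair a b) F].

(* Formulas with bounded quantifiers, variables as de Bruijn indices: the
   quantifiers "for all / exists x in v_j" bind the variable 0 of their body. *)
Inductive bformula :=
| BElem of nat & nat
| BEq of nat & nat
| BNot of bformula
| BAnd of bformula & bformula
| BOr of bformula & bformula
| BImp of bformula & bformula
| BAll of nat & bformula
| BEx of nat & bformula.

Definition push (T : Type) (x : T) (rho : nat -> T) : nat -> T :=
  fun n => if n is k.+1 then rho k else x.

Fixpoint bholds X (V : superstructure X) (rho : nat -> V) (phi : bformula) :
    Prop :=
  match phi with
  | BElem i j => elem (rho i) (rho j)
  | BEq i j => rho i = rho j
  | BNot p => ~ bholds rho p
  | BAnd p q => bholds rho p /\ bholds rho q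
  | BOr p q => bholds rho p \/ bholds rho q
  | BImp p q => bholds rho p -> bholds rho q
  | BAll j p => forall x, elem x (rho j) -> bholds (push x rho) p
  | BEx j p => exists x, elem x (rho j) /\ bholds (push x rho) p
  end.

(* Y plays the role of *X. The standard parameters of the transferred formula
   are the values of rho. *)
Record nsextension X Y (V : superstructure X) (W : superstructure Y) :=
  NSExtension {
  star_map :> V -> W;
  star_base : star_map (vbase V) = vbase W;
  transfer : forall (phi : bformula) (rho : nat -> V),
    bholds rho phi <-> bholds (star_map \o rho) phi
}.

Definition internal X Y (V : superstructure X) (W : superstructure Y)
    (star : nsextension V W) : set W :=
  [set w | exists A : V, elem w (star A)].

(* kappa-saturation, where kappa is the cardinality of the type K *)
Definition saturated X Y (V : superstructure X) (W : superstructure Y)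
    (star : nsextension V W) (K : Type) : Prop :=
  forall F : set W,
    (forall A, F A -> internal star A /\ is_vset A) ->
    ~ ([set: K] #<= F) ->
    (forall G : set W, finite_set G -> G `<=` F ->
      exists w, forall A, G A -> elem w A) ->
    exists w, forall A, F A -> elem w A.

Definition polysaturated X Y (V : superstructure X) (W : superstructure Y)
    (star : nsextension V W) : Prop :=
  exists K : Type, ~ ([set: K] #<= [set: V]) /\ saturated star K.

Definition pderiv (R : realType) m (i : 'I_m) (f : 'rV[R]_m -> R) :
  'rV[R]_m -> R := fun x => 'D_(delta_mx 0 i) f x.

Fixpoint class_C (R : realType) m (k : nat) (f : 'rV[R]_m -> R) : Prop :=
  if k is l.+1 then
    continuous f /\ forall i : 'I_m,
      (forall x, derivable f x (delta_mx 0 i)) /\ class_C l (pderiv i f)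
  else continuous f.

Definition smooth (R : realType) m (f : 'rV[R]_m -> R) : Prop :=
  forall k, class_C k f.

Record Cinf (R : realType) (m : nat) := MkCinf {
  Cinf_fun :> 'rV[R]_m -> R;
  Cinf_smooth : smooth Cinf_fun
}.

(* multi-indices of length m and order at most k *)
Definition mindex (m k : nat) :=
  {a : {ffun 'I_m -> 'I_k.+1} | (\sum_i a i <= k)%N}.

Definition morder m k (a : mindex m k) : nat := (\sum_i val a i)%N.

Definition mpderiv (R : realType) m k (a : mindex m k) (f : 'rV[R]_m -> R) :
    'rV[R]_m -> R :=
  foldr (fun i h => iter (val a i) (pderiv i) h) f (enum 'I_m).

Definition jet (R : realType) m (k : nat) (x : 'rV[R]_m) (f : 'rV[R]_m -> R) :
  {ffun mindex m k -> R} := [ffun a => mpderiv a f x].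

Record LPDO (R : realType) (m r : nat) := MkLPDO {
  coef : mindex m r -> Cinf R m
}.

Definition lpdo_apply (R : realType) m r (P : LPDO R m r)
    (f : 'rV[R]_m -> R) : 'rV[R]_m -> R :=
  fun x => \sum_(a : mindex m r) coef P a x * mpderiv a f x.

(* a linear form on the space of r-jets at x *)
Definition psymbol (R : realType) m r (P : LPDO R m r) (x : 'rV[R]_m) :
    {ffun mindex m r -> R} -> R :=
  fun y => \sum_(a : mindex m r | morder a == r) coef P a x * y a.

(* The base set contains the reals through iota; N is a subset of R, and a tuple
   (a_0, ..., a_(m-1)) is the function i |-> a_i on {0, ..., m-1}. *)
Section Codes.
Context (R : realType) (X : Type) (iota : R -> X) (V : superstructure X).

Definition vreal (t : R) : V := atom V (iota t).

Definition vnat (n : nat) : V := vreal n%:R.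

Definition vNat : V := vset (range vnat).

Definition vtuple m (a : 'I_m -> V) : V := vgraph (fun i : 'I_m => vnat i) a.

Definition vpoint m (x : 'rV[R]_m) : V := vtuple (fun i => vreal (x 0 i)).

Definition vmindex m k (a : mindex m k) : V := vtuple (fun i => vnat (val a i)).

Definition vfunction m (f : 'rV[R]_m -> R) : V :=
  vgraph (@vpoint m) (fun x => vreal (f x)).

Definition vCinf m : V := vset (range (fun f : Cinf R m => vfunction f)).

Definition vjet m k (u : {ffun mindex m k -> R}) : V :=
  vgraph (@vmindex m k) (fun a => vreal (u a)).

(* the map (k, x, f) |-> j^k_x f on N x R^m x Cinf *)
Definition vjetmap m : V :=
  vgraph (fun t : nat * 'rV[R]_m * Cinf R m =>
            vpair (vpair (vnat t.1.1) (vpoint t.1.2)) (vfunction t.2))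
         (fun t => vjet (jet t.1.1 t.1.2 t.2)).

Definition vlpdo m r (P : LPDO R m r) : V :=
  vgraph (fun f : Cinf R m => vfunction f)
         (fun f => vfunction (lpdo_apply P f)).

End Codes.

(* the internal sequence k |-> *j^k_xi h, k in *N, as the set of its pairs *)
Definition star_jinf (R : realType) X (iota : R -> X) Y (V : superstructure X)
    (W : superstructure Y) (star : nsextension V W) (m : nat) (xi h : W) :
    set (W * W) :=
  [set p | elem p.1 (star (vNat iota V)) /\
           p.2 = vapp (star (vjetmap iota V m)) (vpair (vpair p.1 xi) h)].

(* Main.v *)
Require Import Defs.
From mathcomp Require Import all_boot all_order all_algebra.
From mathcomp Require Import all_classical all_reals all_analysis.
From mathcomp Require Import ring lra zify.

(* By saturation and transfer it is enough to solve, for finitely many points p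
   and g smooth, the equation "P f - g is flat at every p". Fix at each p, among
   the multi-indices a with f_a(p) <> 0, the largest one a0 for a graded monomial
   order. If u(x) is a product of the functions e sin((x_i - p_i) / e) whose
   leading monomial at p is (x - p)^(b + a0), then d^b (P u)(p) <> 0, while
   d^c (P u)(p) = 0 for all c <> b which do not exceed b in the monomial order;
   a further product of sines makes u flat to high order at the other points. As
   e tends to 0, the derivatives of u of order less than |b| + |a0| tend to 0
   uniformly, so that f is obtained as a series of multiples of such functions,
   as in Borel's lemma, each prescribed derivative being corrected in turn. *)

Set Implicit Arguments.
Unset Strict Implicit.
Unset Printing Implicit Defensive.

Import Order.TTheory GRing.Theory Num.Theory.
Import numFieldNormedType.Exports.

Local Open Scope classical_set_scope.
Local Open Scope ring_scope.

(** * Iterated partial derivatives indexed by words *)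

Section Words.
Variables (R : realType) (m : nat).
Local Notation E := 'rV[R]_m.
Implicit Types (f g : E -> R) (w v : seq 'I_m) (x : E).

(** Sines replace the monomials of Borel's lemma because all their derivatives are bounded on the
    whole space: [e sin (x_i / e)] has derivative 1 at the origin, while its derivatives of order k
    are at most [e^(1-k)]. All estimates are therefore global in x. The obstacle is the variable
    coefficients of [P]. In a derivative of [P u] at p, Leibniz' rule lets derivatives fall on
    coefficients, even on those vanishing at p, and every index a of order at most r competes with
    a0. The monomial order is therefore realised by an additive weight for which a single derivative
    spent on a coefficient costs more than any index a can gain over a0. The conditions at p then
    form a triangular system with diagonal entries f_a0(p) d^(b+a0) u(p). The second factor is
    bounded below independently of e, so the multipliers stay bounded as e tends to 0. On the
    nonstandard side, saturation only has to gather the standard points x, at most as many as the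
    elements of [V]. Agreement at infinite orders comes from transferring a statement quantified
    over all k in N. *)

Definition dword w f : E -> R := foldr (fun i h => pderiv i h) f w.

Definition wsmooth f := forall w,
  continuous (dword w f) /\
  forall i x, derivable (dword w f) x (delta_mx 0 i).

Lemma dword_cat w v f : dword (w ++ v) f = dword w (dword v f).
Proof. exact: foldr_cat. Qed.

Lemma dword_rcons w i f : dword (rcons w i) f = dword w (pderiv i f).
Proof. by rewrite -cats1 dword_cat. Qed.

Lemma smooth_pderiv f i : smooth f -> smooth (pderiv i f).
Proof. by move=> sf k; have [_ /(_ i)[]] := sf k.+1. Qed.

Lemma smooth_dword w f : smooth f -> smooth (dword w f).
Proof. by move=> sf; elim: w => // i w; exact: smooth_pderiv. Qed.

Lemma smoothP f : smooth f <-> wsmooth f.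
Proof.
split=> [sf w|wf k].
  have /(_ 1%N)[c d] := smooth_dword w sf.
  by split=> // i x; have [] := d i.
elim: k f wf => [|k IH] f wf; first by have [] := wf [::].
have [c d] := wf [::]; split=> // i; split; first exact: d.
by apply: IH => w; rewrite -dword_rcons; exact: wf.
Qed.

Lemma is_derive_dword f w i x : smooth f ->
  is_derive x (delta_mx 0 i) (dword w f) (dword (i :: w) f x).
Proof. by move=> /smoothP/(_ w)[_ d]; exact: derivableP. Qed.

Lemma continuous_dword f w : smooth f -> continuous (dword w f).
Proof. by move=> /smoothP/(_ w)[]. Qed.

(* A function is smooth as soon as candidates for all its iterated partial
   derivatives are given, indexed by words. *)
Lemma tower_dword (D : seq 'I_m -> E -> R) :
  (forall w i x, is_derive x (delta_mx 0 i) (D w) (D (i :: w) x)) ->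
  forall w, dword w (D [::]) = D w.
Proof.
move=> dD; elim=> // i w IH /=; rewrite IH; apply/funext => x.
by rewrite /pderiv; have [] := dD w i x.
Qed.

Lemma tower_smooth (D : seq 'I_m -> E -> R) :
  (forall w, continuous (D w)) ->
  (forall w i x, is_derive x (delta_mx 0 i) (D w) (D (i :: w) x)) ->
  smooth (D [::]).
Proof.
move=> cD dD; apply/smoothP => w; rewrite (tower_dword dD); split; first exact: cD.
by move=> i x; have [] := dD w i x.
Qed.

(* The pairs of complementary subwords of w: the index set of Leibniz' rule. *)
Fixpoint splits w : seq (seq 'I_m * seq 'I_m) :=
  if w is i :: w' then
    [seq (s.1, i :: s.2) | s <- splits w'] ++
    [seq (i :: s.1, s.2) | s <- splits w']
  else [:: ([::], [::])].

Lemma splits_perm w s : s \in splits w -> perm_eq (s.1 ++ s.2) w.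
Proof.
elim: w s => [|i w IH] s; first by rewrite inE => /eqP ->.
rewrite /= mem_cat => /orP[] /mapP[t /IH tw ->] /=.
  by rewrite perm_catC/= perm_cons perm_catC.
by rewrite perm_cons.
Qed.

(** The term [([::], w)] is the one where no derivative falls on the left factor. The others vanish
    if that factor is constant, and are controlled by weight if it is a coefficient of [P]. *)
Lemma splits_head w :
  exists2 L, splits w = ([::], w) :: L & all (fun s => s.1 != [::]) L.
Proof.
elim: w => [|i w [L sw aL]]; first by exists [::].
exists ([seq (s.1, i :: s.2) | s <- L] ++
        [seq (i :: s.1, s.2) | s <- ([::], w) :: L]); first by rewrite /= sw.
rewrite all_cat !all_map /=; apply/andP; split.
  by apply: sub_all aL => s /=.
by apply/allP.
Qed.

Lemma mem_splits w u v : perm_eq (u ++ v) w ->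
  exists2 s, s \in splits w & perm_eq s.1 u && perm_eq s.2 v.
Proof.
elim: w u v => [|i w IH] u v.
  move/perm_size/eqP; rewrite size_cat addn_eq0 !size_eq0 => /andP[/eqP-> /eqP->].
  by exists ([::], [::]); rewrite ?inE.
move=> uv; have : i \in u ++ v by rewrite (perm_mem uv) mem_head.
rewrite mem_cat => /orP[] iu.
  have uiu := perm_to_rem iu.
  have /IH[s sw /andP[s1 s2]] : perm_eq (rem i u ++ v) w.
    by rewrite -(perm_cons i) -(permPr uv) -cat_cons perm_cat2r perm_sym.
  exists (i :: s.1, s.2); first by rewrite /= mem_cat (map_f (fun s => (i :: s.1, s.2))) ?orbT.
  by rewrite /= s2 andbT (permPr uiu) perm_cons.
have viv := perm_to_rem iu.
have /IH[s sw /andP[s1 s2]] : perm_eq (u ++ rem i v) w.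
  rewrite -(perm_cons i) -(permPr uv) -[i :: _ ++ _]/([:: i] ++ (u ++ rem i v)).
  by rewrite perm_catCA perm_cat2l perm_sym.
exists (s.1, i :: s.2); first by rewrite /= mem_cat (map_f (fun s => (s.1, i :: s.2))).
by rewrite /= s1 /= (permPr viv) perm_cons.
Qed.

Section Closure.
Variables (f g : E -> R) (sf : smooth f) (sg : smooth g).

Definition mul_tower w x := \sum_(s <- splits w) dword s.1 f x * dword s.2 g x.

Lemma is_derive_mul_tower w i x :
  is_derive x (delta_mx 0 i) (mul_tower w) (mul_tower (i :: w) x).
Proof.
rewrite /mul_tower /= big_cat /= !big_map /= -big_split /=.
elim: (splits w) => [|s L IH].
  rewrite big_nil (_ : (fun=> _) = cst 0); last by apply/funext => y; rewrite big_nil.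
  exact: is_derive_cst.
rewrite (_ : (fun=> _) = (dword s.1 f * dword s.2 g) +
   (fun y => \sum_(s <- L) dword s.1 f y * dword s.2 g y)); last first.
  by apply/funext => y; rewrite big_cons.
rewrite big_cons /=.
have d1 := is_derive_dword s.1 i x sf; have d2 := is_derive_dword s.2 i x sg.
apply: is_deriveD.
by apply: is_derive_eq; rewrite [X in _ + X]mulrC.
Qed.

Lemma continuous_mul_tower w : continuous (mul_tower w).
Proof.
move=> x; rewrite /mul_tower; elim: (splits w) => [|s L IH].
  rewrite (_ : (fun=> _) = cst 0); last by apply/funext => y; rewrite big_nil.
  exact: cst_continuous.
rewrite (_ : (fun=> _) = (dword s.1 f * dword s.2 g) +
   (fun y => \sum_(s <- L) dword s.1 f y * dword s.2 g y)); last first.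
  by apply/funext => y; rewrite big_cons.
apply: continuousD IH.
by apply: continuousM; apply: continuous_dword.
Qed.

Lemma mul_tower0 : mul_tower [::] = f * g.
Proof. by apply/funext => x; rewrite /mul_tower big_seq1. Qed.

Lemma smoothM : smooth (f * g).
Proof.
rewrite -mul_tower0; apply: tower_smooth; first exact: continuous_mul_tower.
exact: is_derive_mul_tower.
Qed.

Lemma dwordM w x :
  dword w (f * g) x = \sum_(s <- splits w) dword s.1 f x * dword s.2 g x.
Proof. by rewrite -mul_tower0 (tower_dword is_derive_mul_tower). Qed.

Let add_tower w := dword w f + dword w g.

Let is_derive_add_tower w i x :
  is_derive x (delta_mx 0 i) (add_tower w) (add_tower (i :: w) x).
Proof.
have d1 := is_derive_dword w i x sf; have d2 := is_derive_dword w i x sg.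
exact: is_deriveD.
Qed.

Lemma smoothD : smooth (f + g).
Proof.
apply: (tower_smooth _ is_derive_add_tower) => w x.
by apply: continuousD; apply: continuous_dword.
Qed.

Lemma dwordD w : dword w (f + g) = dword w f + dword w g.
Proof. exact: (tower_dword is_derive_add_tower). Qed.

End Closure.

Let cst_tower (c : R) w : E -> R := cst (if nilp w then c else 0).

Let is_derive_cst_tower c w i x :
  is_derive x (delta_mx 0 i) (cst_tower c w) (cst_tower c (i :: w) x).
Proof. exact: is_derive_cst. Qed.

Lemma smooth_cst (c : R) : smooth (cst c : E -> R).
Proof.
apply: (tower_smooth _ (is_derive_cst_tower c)) => w.
exact: cst_continuous.
Qed.

Lemma dword_cst (c : R) w x : dword w (cst c) x = if nilp w then c else 0.
Proof. by rewrite (tower_dword (is_derive_cst_tower c) w). Qed.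

Lemma dwordZ (c : R) f w x : smooth f -> dword w (cst c * f) x = c * dword w f x.
Proof.
move=> sf; rewrite dwordM//; last exact: smooth_cst.
have [L -> aL] := splits_head w; rewrite big_cons /= big_seq big1 ?addr0// => s sL.
rewrite dword_cst; case: nilP => [s0|_]; last by rewrite mul0r.
by have := allP aL _ sL; rewrite /= s0.
Qed.

End Words.

(** * Sine waves and their iterated derivatives *)

Section Slices.
Variables (R : realType) (m : nat).
Local Notation E := 'rV[R]_m.
Implicit Types (f : E -> R) (w : seq 'I_m) (x : E).

Lemma is_derive_slice f x v (t d : R) :
  is_derive (t *: v + x) v f d <->
  is_derive t 1 (fun h : R => f (h *: v + x)) d.
Proof.
have e : (fun h : R => h^-1 *: ((f \o shift (t *: v + x)) (h *: v) - f (t *: v + x)))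
  = (fun h : R => h^-1 *: (((fun h : R => f (h *: v + x)) \o shift t) (h *: 1)
     - f (t *: v + x))).
  by apply/funext => h /=; rewrite [h%:A]mulr1 scalerDl addrA.
by split=> -[d1 d2]; split; move: d1 d2; rewrite /derivable /derive e.
Qed.

Definition sine_wave (i : 'I_m) (a c : R) : E -> R := fun x => sin (a * (x 0 i - c)).

Let sine_tower i a c w x : R :=
  if all (pred1 i) w then
    a ^+ size w * sin (a * (x 0 i - c) + (size w)%:R * (pi / 2)) else 0.

Let sine_tower0 i a c : sine_tower i a c [::] = sine_wave i a c.
Proof.
by apply/funext => x; rewrite /sine_tower /= expr0 mul1r mul0r addr0.
Qed.

Let is_derive_sine_tower i a c w j x :
  is_derive x (delta_mx 0 j) (sine_tower i a c w) (sine_tower i a c (j :: w) x).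
Proof.
rewrite /sine_tower /=; have [aw|aw] := boolP (all (pred1 i) w); last first.
  rewrite andbF; exact: is_derive_cst.
rewrite andbT -[x in is_derive x]add0r -(scale0r (delta_mx 0 j)).
apply/is_derive_slice.
have [->|ji] := eqVneq j i.
  rewrite (_ : (fun _ => _) = (fun t => a ^+ size w *
    sin (a * (t + x 0 i - c) + (size w)%:R * (pi / 2)))); last first.
    by apply/funext => t; rewrite !mxE !eqxx /= mulr1.
  apply: is_derive_eq.
  rewrite exprSr -mulrA -[in RHS]natr1 [in RHS]mulrDl mul1r [in RHS]addrA sinDpihalf.
  by rewrite addr0 subr0 addr0 add0r [a *: 1]mulr1 -[_ *: _]/(_ * _) [_ * a]mulrC mulrA.
rewrite (_ : (fun _ => _) = cst (a ^+ size w *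
    sin (a * (x 0 i - c) + (size w)%:R * (pi / 2)))); last first.
  by apply/funext => t; rewrite !mxE eqxx eq_sym (negPf ji) mulr0 add0r.
exact: is_derive_cst.
Qed.

Let continuous_sine_tower i a c w : continuous (sine_tower i a c w).
Proof.
rewrite /sine_tower; case: (all _ w); last exact: cst_continuous.
rewrite (_ : (fun x => _) = cst (a ^+ size w) * (@sin R \o
  (cst a * ((fun x : E => x 0 i) - cst c) + cst ((size w)%:R * (pi / 2)))))//.
move=> x; apply: continuousM; first exact: cst_continuous.
apply: continuous_comp; last exact: continuous_sin.
apply: continuousD; last exact: cst_continuous.
apply: continuousM; first exact: cst_continuous.
apply: continuousB; last exact: cst_continuous.
exact: coord_continuous.
Qed.

Lemma smooth_sine_wave i a c : smooth (sine_wave i a c).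
Proof.
rewrite -sine_tower0.
exact: (@tower_smooth _ _ (sine_tower i a c)).
Qed.

Lemma dword_sine_wave i a c w x : dword w (sine_wave i a c) x =
  if all (pred1 i) w then
    a ^+ size w * sin (a * (x 0 i - c) + (size w)%:R * (pi / 2)) else 0.
Proof.
by rewrite -sine_tower0 (tower_dword (is_derive_sine_tower i a c)).
Qed.

End Slices.

(** * Series of smooth functions *)

Section SmoothSeries.
Variables (R : realType) (m : nat).
Local Notation E := 'rV[R]_m.

Lemma mvt_dist (phi phi' : R -> R) (a b : R) :
  (forall t : R, is_derive t 1 phi (phi' t)) ->
  exists2 c, `|c - a| <= `|b - a| & phi b - phi a = phi' c * (b - a).
Proof.
move=> d; have cphi (A : set R) : {within A, continuous phi}.
  apply: continuous_subspaceT => t.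
  by apply: differentiable_continuous; apply/derivable1_diffP; have [] := d t.
have [ab|ba] := leP a b.
  have [c /[!in_itv]/= /andP[ac cb] e] := MVT_segment ab (fun t _ => d t) (cphi _).
  by exists c => //; rewrite !ger0_norm; lra.
have [c /[!in_itv]/= /andP[ac cb] e] :=
  MVT_segment (ltW ba) (fun t _ => d t) (cphi _).
by exists c; [rewrite !ler0_norm; lra | lra].
Qed.

(** An explicit quadratic remainder bound survives pointwise limits, unlike differentiability
    itself; series are differentiated termwise through it. *)
Lemma is_derive_quadratic (G : E -> R) (x v : E) (d C : R) :
  (forall h : R, `|G (h *: v + x) - G x - h * d| <= C * h ^+ 2) ->
  is_derive x v G d.
Proof.
move=> bG.
have C0 : 0 <= C by have := bG 1; rewrite expr1n mulr1; exact: le_trans.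
suff lim : (fun h : R => h^-1 *: ((G \o shift x) (h *: v) - G x)) @ 0^' --> d.
  by split; [apply/cvg_ex; exists d | exact: cvg_lim lim].
apply/cvgrPdist_le => e e0.
near=> h.
have h0 : h != 0 by near: h; exact: nbhs_dnbhs_neq.
have he : `|h| <= e / (C + 1) by near: h; apply: dnbhs0_le; rewrite divr_gt0//; lra.
have -> : d - h^-1 *: ((G \o shift x) (h *: v) - G x) =
    - (h^-1 * (G (h *: v + x) - G x - h * d)).
  by rewrite [in RHS]mulrBr mulKf// opprB.
rewrite normrN normrM normfV ler_pdivrMl ?normr_gt0//.
apply: le_trans (bG h) _; rewrite -[h ^+ 2]ger0_norm ?sqr_ge0// normrX.
rewrite expr2 mulrCA ler_wpM2l//.
by move: he; rewrite ler_pdivlMr; nra.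
Unshelve. all: by end_near. Qed.

(** Two applications of the mean value theorem along the line: the intermediate point of the first
    is within [|h|] of 0, which gives the second factor [|h|]. *)
Lemma dword_taylor (f : E -> R) w i (M : R) x (h : R) : smooth f ->
  (forall y, `|dword (i :: i :: w) f y| <= M) ->
  `|dword w f (h *: delta_mx 0 i + x) - dword w f x - h * dword (i :: w) f x|
    <= M * h ^+ 2.
Proof.
move=> sf bM; pose v : E := delta_mx 0 i.
have d u : forall t : R,
    is_derive t 1 (fun t => dword u f (t *: v + x)) (dword (i :: u) f (t *: v + x)).
  by move=> t; apply/is_derive_slice; exact: is_derive_dword.
have [c ch ec] := mvt_dist 0 h (d w).
have [c' _ ec'] := mvt_dist 0 c (d (i :: w)).
move: ch ec ec'; rewrite !subr0 !scale0r !add0r => ch -> ec'.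
rewrite mulrC -mulrBr ec' normrM normrM -[h ^+ 2]ger0_norm ?sqr_ge0// normrX.
have := bM (c' *: v + x); have := normr_ge0 h; have := normr_ge0 c.
have := normr_ge0 (dword [:: i, i & w] f (c' *: v + x)) => *.
by rewrite expr2 mulrC mulrA ler_wpM2r// ler_pM.
Qed.

Lemma geometric_bound_cvg (u : R^nat) (M : R) :
  (forall n, `|u n| <= M / 2 ^+ n) ->
  cvgn (series u) /\
  forall N, `|limn (series u) - series u N| <= M * 2 / 2 ^+ N.
Proof.
move=> bu.
have p2 n : 0 < 2 ^+ n :> R by rewrite exprn_gt0.
have M0 : 0 <= M by have := bu 0%N; rewrite expr0 divr1; exact: le_trans.
have cu : cvgn (series u).
  apply: normed_cvg; apply: (@series_le_cvg _ _ (geometric M 2^-1)) => //.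
  - by move=> n /=.
  - by move=> n; apply: geometric_ge0; rewrite ?invr_ge0.
  - by move=> n; rewrite /= exprVn.
  - by apply: is_cvg_geometric_series; rewrite ger0_norm// invf_lt1 ?ltr1n.
split=> // N.
have tail n : `|series u (N + n)%N - series u N| <= M * 2 / 2 ^+ N.
  (* Subtracting the remaining geometric tail makes the bound exact enough for induction on n. *)
  suff : `|series u (N + n)%N - series u N| <= M * 2 / 2 ^+ N - M * 2 / 2 ^+ (N + n)%N.
    move/le_trans; apply; rewrite gerBl divr_ge0// ?mulr_ge0//; exact: ltW.
  elim: n => [|n IH]; first by rewrite addn0 !subrr normr0.
  rewrite addnS seriesSr addrAC; apply: le_trans (ler_normD _ _) _.
  apply: le_trans (lerD IH (bu _)) _.
  by rewrite exprS invfM; lra.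
have cv : (fun n => `|series u n - series u N|) @ \oo --> `|limn (series u) - series u N|.
  by apply: cvg_norm; apply: cvgB; [exact: cu|exact: cvg_cst].
rewrite -(cvg_lim _ cv)//; apply: limr_le; first by apply/cvg_ex; eexists; exact: cv.
near=> n.
have Nn : (N <= n)%N by near: n; exists N.
by rewrite -(subnKC Nn).
Unshelve. all: by end_near. Qed.

Lemma smooth_series (f : nat -> E -> R) : (forall n, smooth (f n)) ->
  (forall w, exists M, forall n x, `|dword w (f n) x| <= M / 2 ^+ n) ->
  exists2 F, smooth F & forall w x,
    series (fun n => dword w (f n) x) @ \oo --> dword w F x.
Proof.
move=> sf bf.
pose D w x := limn (series (fun n => dword w (f n) x)).
have cvD w x : series (fun n => dword w (f n) x) @ \oo --> D w x.
  have [M bM] := bf w.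
  by have [] := geometric_bound_cvg (fun n => bM n x).
have cD w : continuous (D w).
  move=> x; have [M bM] := bf w.
  have tail N y := (geometric_bound_cvg (fun n => bM n y)).2 N.
  apply/(@cvgrPdist_le _ _ _ _ (nbhs_filter x)) => e e0.
  have [N MN] : exists N, M * 2 / 2 ^+ N <= e / 3.
    have /cvgrPdist_le/(_ (e / 3)) : geometric (M * 2) 2^-1 @ \oo --> (0 : R).
      by apply: cvg_geometric; rewrite ger0_norm// invf_lt1 ?ltr1n.
    case; first lra.
    move=> N _ /(_ N (leqnn N)) /=; rewrite sub0r normrN exprVn => b.
    by exists N; apply: le_trans b; exact: ler_norm.
  have cS : continuous (fun y => series (fun n => dword w (f n) y) N).
    rewrite /series /=; elim: N {MN} => [|N IH].
      under eq_fun do rewrite big_nil.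
      exact: cst_continuous.
    under eq_fun do rewrite big_nat_recr//=.
    by move=> y; apply: continuousD; [exact: IH|exact: continuous_dword].
  have /cvgrPdist_le/(_ (e / 3)) cSx := cS x.
  apply: (@filterS _ _ (nbhs_filter x) _ _ _ (cSx _)); last lra.
  move=> y xy.
  have := tail N x; have := tail N y; rewrite -/(D w x) -/(D w y) => ty tx.
  move: (le_trans ty MN) (le_trans tx MN) xy; rewrite !ler_norml.
  by move=> /andP[? ?] /andP[? ?] /andP[? ?]; apply/andP; split; lra.
have dD w i x : is_derive x (delta_mx 0 i) (D w) (D (i :: w) x).
  have [M bM] := bf (i :: i :: w).
  apply: (@is_derive_quadratic _ _ _ _ (M * 2)) => h.
  set y := h *: _ + x.
  have cv : (fun N => `|series (fun n => dword w (f n) y) N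
      - series (fun n => dword w (f n) x) N
      - h * series (fun n => dword (i :: w) (f n) x) N|) @ \oo -->
      `|D w y - D w x - h * D (i :: w) x|.
    apply: cvg_norm; apply: cvgB; first by apply: cvgB; exact: cvD.
    by apply: cvgM; [exact: cvg_cst|exact: cvD].
  rewrite -(cvg_lim _ cv)//; apply: limr_le; first by apply/cvg_ex; eexists; exact: cv.
  apply: nearW => N.
  rewrite /series /= mulr_sumr -!sumrB.
  have p2 n : 0 < 2 ^+ n :> R by rewrite exprn_gt0.
  (* The Taylor constants [M / 2 ^+ n] of the terms add up to this partial geometric sum, again the
     form that passes through the induction. *)
  apply: (@le_trans _ _ ((M * 2 - M * 2 / 2 ^+ N) * h ^+ 2)); last first.
    have := le_trans (normr_ge0 _) (bM 0 x); rewrite expr0 divr1 => M0.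
    by rewrite ler_wpM2r ?sqr_ge0// gerBl divr_ge0 ?mulr_ge0// ltW.
  elim: N => [|k IH]; first by rewrite big_nil normr0 expr0 divr1 subrr mul0r.
  rewrite big_nat_recr//=; apply: le_trans (ler_normD _ _) _.
  apply: le_trans (lerD IH (dword_taylor x h (sf k) (bM k))) _.
  by rewrite -mulrDl ler_wpM2r ?sqr_ge0// exprS invfM; lra.
exists (D [::]); first exact: (@tower_smooth _ _ D).
by move=> w x; rewrite (tower_dword dD).
Unshelve. all: by end_near. Qed.

End SmoothSeries.

(** * Functions with prescribed leading monomial *)

Section Blocks.
Variables (R : realType) (m : nat).
Local Notation E := 'rV[R]_m.
Implicit Types (u : E -> R) (v w : seq 'I_m) (p q x : E).

Definition subcount v w := [forall i, count_mem i v <= count_mem i w]%N.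

Lemma subcountP v w :
  reflect (forall i : 'I_m, (count_mem i v <= count_mem i w)%N) (subcount v w).
Proof. exact: forallP. Qed.

(** Models the monomial (x - p)^v. A lower bound on the leading derivative, rather than its value,
    is enough to normalise by it; it covers every ordering of the letters of v. *)
Definition leading v (kappa : R) p u :=
  (forall w, ~~ subcount v w -> dword w u p = 0) /\
  (forall w, perm_eq w v -> kappa <= dword w u p).

Definition flat_upto (k : nat) q u := forall w, (size w < k)%N -> dword w u q = 0.

(* The growth of the derivatives of a function which is homogeneous of degree d
   in the scale e. *)
Definition scaled (C : seq 'I_m -> R) (d : nat) (e : R) u :=
  forall w x, e ^+ size w * `|dword w u x| <= C w * e ^+ d.

Lemma count_splits w s i : s \in splits w ->
  (count_mem i s.1 + count_mem i s.2 = count_mem i w)%N.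
Proof. by move=> /splits_perm/permP <-; rewrite count_cat. Qed.

Lemma size_splits w s : s \in splits w -> (size s.1 + size s.2 = size w)%N.
Proof. by move=> /splits_perm/perm_size <-; rewrite size_cat. Qed.

(** In the Leibniz sum a nonzero term needs both parts to dominate v1 and v2. For a word with the
    letters of [v1 ++ v2] this forces equality of counts, so all surviving terms are nonnegative,
    and at least one is present. *)
Lemma leadingM v1 k1 v2 k2 p u1 u2 : smooth u1 -> smooth u2 ->
  0 <= k1 -> 0 <= k2 -> leading v1 k1 p u1 -> leading v2 k2 p u2 ->
  leading (v1 ++ v2) (k1 * k2) p (u1 * u2).
Proof.
move=> s1 s2 k10 k20 [z1 l1] [z2 l2]; split=> w vw; rewrite dwordM//.
  rewrite big_seq big1// => s sw.
  have [v1s|/z1 ->] := boolP (subcount v1 s.1); last by rewrite mul0r.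
  have [v2s|/z2 ->] := boolP (subcount v2 s.2); last by rewrite mulr0.
  case/negP: vw; apply/subcountP => i; rewrite count_cat -(count_splits i sw).
  by rewrite leq_add// (subcountP _ _ v1s, subcountP _ _ v2s).
have ge0 s : s \in splits w -> 0 <= dword s.1 u1 p * dword s.2 u2 p.
  move=> sw.
  have [/subcountP v1s|/z1 ->] := boolP (subcount v1 s.1); last by rewrite mul0r.
  have [/subcountP v2s|/z2 ->] := boolP (subcount v2 s.2); last by rewrite mulr0.
  have e i : (count_mem i s.1 == count_mem i v1) && (count_mem i s.2 == count_mem i v2).
    have := v1s i; have := v2s i; have := count_splits i sw.
    by rewrite (permP vw) count_cat; lia.
  have p1 : perm_eq s.1 v1 by apply/allP => i _; case/andP: (e i).
  have p2 : perm_eq s.2 v2 by apply/allP => i _; case/andP: (e i).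
  by rewrite mulr_ge0// (le_trans _ (l1 _ p1), le_trans _ (l2 _ p2)).
have [s sw /andP[p1 p2]] : exists2 s, s \in splits w &
    perm_eq s.1 v1 && perm_eq s.2 v2 by apply: mem_splits; rewrite perm_sym.
rewrite (perm_big _ (perm_to_rem sw)) big_cons -[leLHS]addr0 lerD//.
  by rewrite ler_pM// (l1, l2).
by rewrite big_seq sumr_ge0// => t /mem_rem; exact: ge0.
Qed.

Lemma flat_uptoM k1 k2 q u1 u2 : smooth u1 -> smooth u2 ->
  flat_upto k1 q u1 -> flat_upto k2 q u2 -> flat_upto (k1 + k2)%N q (u1 * u2).
Proof.
move=> s1 s2 f1 f2 w wk; rewrite dwordM// big_seq big1// => s /size_splits sw.
have [/f1 ->|k1s] := ltnP (size s.1) k1; first by rewrite mul0r.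
by rewrite f2 ?mulr0// -(ltn_add2l (size s.1)) sw (leq_trans wk)// leq_add2r.
Qed.

Lemma scaledM C1 d1 C2 d2 e u1 u2 : 0 <= e -> smooth u1 -> smooth u2 ->
  scaled C1 d1 e u1 -> scaled C2 d2 e u2 ->
  scaled (fun w => \sum_(s <- splits w) C1 s.1 * C2 s.2) (d1 + d2)%N e (u1 * u2).
Proof.
move=> e0 s1 s2 b1 b2 w x; rewrite dwordM//.
apply: (@le_trans _ _ (e ^+ size w *
    \sum_(s <- splits w) `|dword s.1 u1 x * dword s.2 u2 x|)).
  by rewrite ler_wpM2l ?exprn_ge0// ler_norm_sum.
rewrite mulr_sumr mulr_suml big_seq [leRHS]big_seq; apply: ler_sum => s sw.
rewrite -(size_splits sw) normrM !exprD mulrACA [leRHS]mulrACA.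
by rewrite ler_pM// mulr_ge0// exprn_ge0.
Qed.

Lemma leading_flat_family p v (qs : seq E) : p \notin qs ->
  exists (kappa : R) C, 0 < kappa /\ forall e : R, 0 < e <= 1 -> exists u,
    [/\ smooth u, scaled C (size v) e u, leading v kappa p u &
        forall q, flat_upto (count_mem q qs) q u].
Proof.
elim: qs => [_|q qs IH].
  elim: v => [|i v [k [C [k0 IH]]]].
    exists 1, (fun=> 1); split=> // e /andP[e0 e1]; exists (cst 1); split=> //.
    - exact: smooth_cst.
    - move=> w x; rewrite expr0 mulr1 dword_cst; case: nilP => _.
        by rewrite normr1 mulr1 exprn_ile1// ltW.
      by rewrite normr0 mulr0.
    - split=> w; first by move=> /subcountP[]; move=> i.
      by move=> /perm_nilP ->; rewrite dword_cst.
  exists (1 * k), (fun w => \sum_(s <- splits w) 1 * C s.2).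
  split=> [|e e01]; first by rewrite mul1r.
  have [u [su bu lu fu]] := IH e e01; case/andP: e01 => e0 e1.
  pose s := cst e * sine_wave i e^-1 (p 0 i).
  have ss : smooth s by apply: smoothM; [exact: smooth_cst|exact: smooth_sine_wave].
  have ds w x : dword w s x = e * (if all (pred1 i) w then
    e^-1 ^+ size w * sin (e^-1 * (x 0 i - p 0 i) + (size w)%:R * (pi / 2)) else 0).
    by rewrite dwordZ ?dword_sine_wave//; exact: smooth_sine_wave.
  exists (s * u); split; first exact: smoothM.
  - apply: (@scaledM (fun=> 1) 1) => //; first exact: ltW.
    move=> w x; rewrite ds mul1r expr1; case: ifP => _; last by rewrite mulr0 normr0 mulr0 ltW.
    rewrite !normrM (gtr0_norm e0) normrX gtr0_norm ?invr_gt0// exprVn mulrCA.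
    by rewrite mulVKf ?expf_neq0 ?gt_eqF// ler_piMr ?sin_max// ltW.
  - rewrite -cat1s; apply: leadingM => //; [exact: ltW|].
    split=> w.
      rewrite ds; case: ifPn => aw iw; last by rewrite mulr0.
      suff -> : w = [::] by rewrite /= subrr mulr0 mul0r addr0 sin0 !mulr0.
      case: w aw iw => // j w /= /andP[/eqP -> _] /subcountP[] l.
      by rewrite /= addn0; case: (i == l).
    move=> /perm_small_eq -> //.
    by rewrite ds /= eqxx /= subrr mulr0 add0r mul1r sin_pihalf mulr1 expr1 mulfV ?gt_eqF.
  - by move=> q w; rewrite ltn0.
rewrite inE negb_or => /andP[pq /IH[k [C [k0 {}IH]]]].
have [i piq] : exists i, p 0 i != q 0 i.
  apply/existsP; apply: contra_neqT pq; rewrite negb_exists => /forallP e.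
  by apply/rowP => i; apply/eqP; move: (e i); rewrite negbK.
(* The frequency puts a zero of the sine at q and the value [sin (pi / 2) = 1] at p; it is
   independent of e, so this factor has scaling degree 0. *)
pose a := pi / 2 / (p 0 i - q 0 i).
pose s : E -> R := sine_wave i a (q 0 i).
have ss : smooth s by exact: smooth_sine_wave.
exists (1 * k), (fun w => \sum_(s <- splits w) `|a| ^+ size s.1 * C s.2).
split=> [|e e01]; first by rewrite mul1r.
have [u [su bu lu fu]] := IH e e01; case/andP: e01 => e0 e1.
exists (s * u); split; first exact: smoothM.
- rewrite -[size v]add0n; apply: (@scaledM (fun w => `|a| ^+ size w)) => //; first exact: ltW.
  move=> w x; rewrite dword_sine_wave expr0 mulr1.
  case: ifP => _; last by rewrite normr0 mulr0 exprn_ge0.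
  rewrite normrM normrX mulrCA -[leRHS]mulr1 ler_wpM2l ?exprn_ge0//.
  by rewrite mulr_ile1 ?exprn_ge0 ?exprn_ile1 ?sin_max// ltW.
- rewrite -[v]cat0s; apply: leadingM => //; first exact: ltW.
  split=> w; first by move=> /subcountP[]; move=> j.
  move=> /perm_nilP ->; rewrite dword_sine_wave /= expr0 mul1r mul0r addr0.
  by rewrite divfK ?subr_eq0// sin_pihalf.
- move=> q' /=; apply: flat_uptoM => //.
  case: eqP => [<-|_]; last by move=> w; rewrite ltn0.
  case=> // _; rewrite dword_sine_wave /= subrr mulr0 mul0r addr0 sin0 mulr0 //.
Qed.

End Blocks.

(** * An additive weight realising the monomial order *)

Section Weights.
Variables (m r : nat).
Implicit Types (v w : seq 'I_m).

Definition mword (b : 'I_m -> nat) : seq 'I_m :=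
  flatten [seq nseq (b i) i | i <- enum 'I_m].

Lemma count_mword b (i : 'I_m) : count_mem i (mword b) = b i.
Proof.
rewrite /mword count_flatten sumnE 2!big_map big_enum /= (bigD1 i)//= big1 ?addn0.
  by rewrite count_nseq /= eqxx mul1n.
by move=> j ji; rewrite count_nseq /= (negPf ji) mul0n.
Qed.

Lemma size_mword b : size (mword b) = (\sum_i b i)%N.
Proof.
rewrite /mword size_flatten /shape sumnE 2!big_map big_enum /=.
by apply: eq_bigr => i _; rewrite size_nseq.
Qed.

(** Jets only contain the derivatives taken in the order fixed by [mpderiv]. This selects that
    ordering, one word for each multi-index, so that each condition is prescribed once. *)
Definition canonical w := w == mword (fun i => count_mem i w).

Lemma canonical_mword b : canonical (mword b).
Proof.
by apply/eqP; congr mword; apply/funext => i; rewrite count_mword.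
Qed.

Lemma canonical_perm v w : canonical v -> canonical w -> perm_eq v w = (v == w).
Proof.
move=> /eqP cv /eqP cw; apply/idP/eqP => [/permP e|-> //].
by rewrite cv cw; congr mword; apply/funext => i; rewrite e.
Qed.

(* Words are compared by length first; on words of length at most r, the words
   of the same length are compared through the digits of a base r+1 expansion. *)
Definition digits w := (\sum_(i <- w) r.+1 ^ i)%N.

Definition weight w := (size w * r.+1 ^ m + digits w)%N.

Lemma digits_cat v w : digits (v ++ w) = (digits v + digits w)%N.
Proof. exact: big_cat. Qed.

Lemma weight_cat v w : weight (v ++ w) = (weight v + weight w)%N.
Proof. by rewrite /weight digits_cat size_cat mulnDl addnACA. Qed.

Lemma digitsE w : digits w = (\sum_(i < m) count_mem i w * r.+1 ^ i)%N.
Proof.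
elim: w => [|j w IH]; first by rewrite /digits big_nil big1.
rewrite /digits big_cons -/(digits w) IH /= [in RHS](eq_bigr (fun i : 'I_m =>
  (j == i) * r.+1 ^ i + count_mem i w * r.+1 ^ i))%N; last first.
  by move=> i _; rewrite mulnDl.
rewrite big_split /=; congr (_ + _)%N.
rewrite (bigD1 j)//= eqxx mul1n big1 ?addn0// => i ij.
by rewrite eq_sym (negPf ij).
Qed.

Lemma size_countE w : size w = (\sum_(i < m) count_mem i w)%N.
Proof.
elim: w => [|j w IH]; first by rewrite big1.
rewrite /= big_split /= -IH -add1n; congr (_ + _)%N.
by rewrite (bigD1 j)//= eqxx big1// => i /negPf; rewrite eq_sym => ->.
Qed.

Lemma weightE w : weight w = (\sum_(i < m) count_mem i w * (r.+1 ^ m + r.+1 ^ i))%N.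
Proof.
rewrite /weight digitsE size_countE big_distrl -big_split /=.
by apply: eq_bigr => i _; rewrite mulnDr.
Qed.

Lemma perm_weight v w : perm_eq v w -> weight v = weight w.
Proof. by move=> /permP e; rewrite !weightE; apply: eq_bigr => i _; rewrite e. Qed.

(** Every letter i has the positive weight [r.+1 ^ m + r.+1 ^ i], so dominating a word with at most
    its weight means having the same letters. The triangular structure rests on this. *)
Lemma subcount_weight v w : subcount v w ->
  (weight v <= weight w ?= iff perm_eq v w)%N.
Proof.
move=> /subcountP vw; rewrite !weightE; split.
  by apply: leq_sum => i _; rewrite leq_mul2r vw orbT.
apply/eqP/idP => [e|/permP e]; last by apply: eq_bigr => i _; rewrite e.
have /leqif_sum [_] : forall i : 'I_m, true ->
  (count_mem i v * (r.+1 ^ m + r.+1 ^ i) <= count_mem i w * (r.+1 ^ m + r.+1 ^ i)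
     ?= iff (count_mem i v == count_mem i w))%N.
  move=> i _; split; first by rewrite leq_mul2r vw orbT.
  by rewrite eqn_pmul2r// addn_gt0 expn_gt0.
by rewrite e eqxx => /esym/forallP h; apply/allP => i _; exact: h.
Qed.

Lemma digits_lt w : (0 < m)%N -> (size w <= r)%N -> (digits w < r.+1 ^ m)%N.
Proof.
move=> m0 wr; apply: (@leq_ltn_trans (size w * r.+1 ^ m.-1)).
  rewrite /digits; elim: w {wr} => [|i w IH]; first by rewrite big_nil.
  by rewrite big_cons mulSn leq_add// leq_pexp2l// -ltnS prednK.
by rewrite -[X in (_ < _ ^ X)%N](prednK m0) expnS ltn_pmul2r ?expn_gt0.
Qed.

(** A word of weight n thus has length at least [n %/ (2 * r.+1 ^ m)]: corrections of high weight
    are small up to high order. *)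
Lemma weight_lt_size w : (weight w <= size w * (2 * r.+1 ^ m))%N.
Proof.
rewrite /weight mul2n -addnn mulnDr leq_add2l /digits.
elim: w => [|i w IH]; first by rewrite big_nil.
by rewrite big_cons mulSn leq_add// leq_pexp2l// ltnW.
Qed.

Lemma size_le_weight w : (size w <= weight w)%N.
Proof. by rewrite (leq_trans _ (leq_addr _ _))// leq_pmulr// expn_gt0. Qed.

Lemma digits_inj n B (a b : 'I_n -> nat) :
  (forall i, a i < B)%N -> (forall i, b i < B)%N ->
  (\sum_i a i * B ^ i = \sum_i b i * B ^ i)%N -> a =1 b.
Proof.
elim: n a b => [|n IH] a b aB bB; first by move=> _ [].
have e (c : 'I_n.+1 -> nat) : (\sum_i c i * B ^ i =
    (\sum_(i < n) c (lift ord0 i) * B ^ i) * B + c ord0)%N.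
  rewrite big_ord_recl expn0 muln1 addnC big_distrl /=; congr (_ + _)%N.
  by apply: eq_bigr => i _; rewrite /bump leq0n add1n expnSr mulnA.
rewrite !e => ab i; have B0 : (0 < B)%N by apply: leq_ltn_trans (aB i).
have ab0 : a ord0 = b ord0.
  by have := congr1 (modn^~ B) ab; rewrite !modnMDl !modn_small.
have : (fun i => a (lift ord0 i)) =1 (fun i => b (lift ord0 i)).
  apply: IH => // ; move: ab; rewrite ab0 => /addIn /eqP.
  by rewrite eqn_pmul2r// => /eqP.
by case: (unliftP ord0 i) => [j ->|->].
Qed.

(** With length at most r every count is a digit in base r+1, and [digits] is recovered modulo
    [r.+1 ^ m]. This separates the indices of [P]; longer words may share a weight and are then
    corrected at the same level. *)
Lemma weight_inj v w : (0 < m)%N -> (size v <= r)%N -> (size w <= r)%N ->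
  weight v = weight w -> perm_eq v w.
Proof.
move=> m0 vr wr /(congr1 (modn^~ (r.+1 ^ m)%N)).
rewrite !modnMDl !modn_small ?digits_lt// !digitsE => e.
apply/allP => i _; apply/eqP; apply: digits_inj e i => i;
  by rewrite ltnS (leq_trans (count_size _ _)).
Qed.

End Weights.

(** * Solving modulo flat functions *)

Section Operator.
Variables (R : realType) (m r : nat) (P : LPDO R m r).
Local Notation E := 'rV[R]_m.
Implicit Types (f u : E -> R) (v w : seq 'I_m) (p q x : E).

Definition idxword k (a : mindex m k) : seq 'I_m := mword (fun i => val a i : nat).

Lemma mpderivE k (a : mindex m k) f : mpderiv a f = dword (idxword a) f.
Proof.
rewrite /mpderiv /idxword /mword; elim: (enum 'I_m) => //= i s ->.
by rewrite dword_cat; elim: (nat_of_ord _) => //= n ->.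
Qed.

Lemma size_idxword k (a : mindex m k) : size (idxword a) = morder a.
Proof. exact: size_mword. Qed.

Lemma size_idxword_le k (a : mindex m k) : (size (idxword a) <= k)%N.
Proof. by rewrite size_idxword; exact: (valP a). Qed.

Lemma canonical_idxword k (a : mindex m k) : canonical (idxword a).
Proof. exact: canonical_mword. Qed.

Lemma idxword_perm_inj k (a b : mindex m k) : perm_eq (idxword a) (idxword b) -> a = b.
Proof.
move=> /permP e; apply/val_inj/ffunP => i; apply/val_inj => /=.
by have := e (pred1 i); rewrite !count_mword.
Qed.

Section Sums.
Variables (I : Type) (s : seq I) (F : I -> E -> R).
Hypothesis sF : forall i, smooth (F i).

Lemma smooth_sum : smooth (fun x => \sum_(i <- s) F i x).
Proof.
elim: s => [|i s' IH].
  rewrite (_ : (fun=> _) = cst 0); last by apply/funext => x; rewrite big_nil.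
  exact: smooth_cst.
rewrite (_ : (fun=> _) = F i + (fun x => \sum_(i <- s') F i x)); last first.
  by apply/funext => x; rewrite big_cons.
exact: smoothD.
Qed.

End Sums.

Lemma dword_sum (I : Type) (s : seq I) (F : I -> E -> R) w x :
  (forall i, smooth (F i)) ->
  dword w (fun x => \sum_(i <- s) F i x) x = \sum_(i <- s) dword w (F i) x.
Proof.
move=> sF; elim: s => [|i s IH].
  rewrite (_ : (fun=> _) = cst 0); last by apply/funext => y; rewrite big_nil.
  by rewrite dword_cst big_nil; case: ifP.
rewrite (_ : (fun=> _) = F i + (fun x => \sum_(i <- s) F i x)); last first.
  by apply/funext => y; rewrite big_cons.
by rewrite dwordD ?big_cons -?IH//; exact: smooth_sum.
Qed.

Let smooth_term f (a : mindex m r) :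
  smooth f -> smooth ((coef P a : E -> R) * dword (idxword a) f).
Proof. by move=> sf; apply: smoothM; [exact: Cinf_smooth|exact: smooth_dword]. Qed.

Let lpdo_applyE f : lpdo_apply P f =
  fun x => \sum_(a : mindex m r) ((coef P a : E -> R) * dword (idxword a) f) x.
Proof. by apply/funext => x; apply: eq_bigr => a _; rewrite mpderivE. Qed.

Lemma smooth_lpdo f : smooth f -> smooth (lpdo_apply P f).
Proof. by move=> sf; rewrite lpdo_applyE; apply: smooth_sum => a; exact: smooth_term. Qed.

Lemma dword_lpdo f w x : smooth f -> dword w (lpdo_apply P f) x =
  \sum_(a : mindex m r) \sum_(s <- splits w)
    dword s.1 (coef P a) x * dword (s.2 ++ idxword a) f x.
Proof.
move=> sf; rewrite lpdo_applyE dword_sum; last by move=> a; exact: smooth_term.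
apply: eq_bigr => a _; rewrite dwordM; first by apply: eq_bigr => s _; rewrite dword_cat.
  exact: Cinf_smooth.
exact: smooth_dword.
Qed.

Lemma dword_lpdoD f u w x : smooth f -> smooth u ->
  dword w (lpdo_apply P (f + u)) x =
  dword w (lpdo_apply P f) x + dword w (lpdo_apply P u) x.
Proof.
move=> sf su; rewrite !dword_lpdo//; last exact: smoothD.
rewrite -big_split; apply: eq_bigr => a _; rewrite -big_split; apply: eq_bigr => s _.
by rewrite dwordD// mulrDr.
Qed.

Lemma dword_lpdoZ c f w x : smooth f ->
  dword w (lpdo_apply P (cst c * f)) x = c * dword w (lpdo_apply P f) x.
Proof.
move=> sf; rewrite !dword_lpdo//; last by apply: smoothM => //; exact: smooth_cst.
rewrite mulr_sumr; apply: eq_bigr => a _; rewrite mulr_sumr; apply: eq_bigr => s _.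
by rewrite dwordZ// mulrCA.
Qed.

Lemma lpdo_flat k q u w : smooth u -> flat_upto k q u -> (size w + r < k)%N ->
  dword w (lpdo_apply P u) q = 0.
Proof.
move=> su fu wk; rewrite dword_lpdo// big1// => a _; rewrite big_seq big1// => s sw.
rewrite fu ?mulr0// size_cat (leq_ltn_trans _ wk)// leq_add ?size_idxword_le//.
by rewrite -(size_splits sw) leq_addl.
Qed.

Local Notation wt := (weight r).

Section Leading.
Variables (m0 : (0 < m)%N) (p : E) (a0 : mindex m r).
Hypothesis order_a0 : size (idxword a0) = r.
Hypothesis max_a0 : forall a, coef P a p != 0 ->
  (wt (idxword a) <= wt (idxword a0))%N.

(** A term survives only if [s.2 ++ idxword a] dominates [w0 ++ idxword a0], hence weighs at least
    as much. If [s.1] is nonempty it removes at least [r.+1 ^ m] from the weight of w, whereas a, of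
    order at most r, exceeds a0, of order exactly r, by less than that; this holds even when f_a(p)
    = 0. If [s.1] is empty, maximality of a0 and injectivity of the weight leave only a = a0. *)
Lemma lpdo_leading kappa w0 u w : smooth u ->
  leading (w0 ++ idxword a0) kappa p u -> (wt w <= wt w0)%N ->
  dword w (lpdo_apply P u) p = coef P a0 p * dword (w ++ idxword a0) u p.
Proof.
move=> su [lu _] ww0; rewrite dword_lpdo//; have [L sw aL] := splits_head w.
have dig (a : mindex m r) : (digits r (idxword a) < r.+1 ^ m)%N.
  by apply: digits_lt => //; exact: size_idxword_le.
transitivity (\sum_(a : mindex m r) coef P a p * dword (w ++ idxword a) u p).
  apply: eq_bigr => a _; rewrite sw big_cons /= big_seq big1 ?addr0// => -[s1 s2] sL /=.
  rewrite lu ?mulr0//; apply/negP => /subcount_weight-/(_ r)[+ _].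
  have sws : (s1, s2) \in splits w by rewrite sw inE sL orbT.
  have s1_gt0 : (0 < size s1)%N by have := allP aL _ sL; case: (s1).
  have := perm_weight r (splits_perm sws); rewrite /= !weight_cat.
  have : (r.+1 ^ m <= wt s1)%N.
    by rewrite (leq_trans _ (leq_addr _ _))// leq_pmull.
  have : (wt (idxword a) <= r * r.+1 ^ m + digits r (idxword a))%N.
    by rewrite leq_add2r leq_mul2r size_idxword_le orbT.
  have : (r * r.+1 ^ m <= wt (idxword a0))%N.
    by rewrite /weight order_a0 leq_addr.
  have := dig a; lia.
rewrite (bigD1 a0)//= big1 ?addr0// => a aa0.
have [->|ca] := eqVneq (coef P a p) 0; first by rewrite mul0r.
rewrite lu ?mulr0//; apply: contra aa0 => /subcount_weight-/(_ r)[+ _].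
rewrite !weight_cat => h; apply/eqP/idxword_perm_inj.
apply: (@weight_inj m r) => //; try exact: size_idxword_le.
by have := max_a0 ca; lia.
Qed.

End Leading.

(** The symbol provides an index of order r with nonzero coefficient; any index of smaller order
    weighs less than [r * r.+1 ^ m], so the heaviest one has order r. *)
Lemma leading_index p : (0 < m)%N -> psymbol P p <> (fun=> 0) -> exists a0 : mindex m r,
  [/\ coef P a0 p != 0, size (idxword a0) = r & forall a, coef P a p != 0 ->
      (wt (idxword a) <= wt (idxword a0))%N].
Proof.
move=> m0 sp.
have [a1 ra1 ca1] : exists2 a, morder a == r & coef P a p != 0.
  apply: contra_notP sp => na; apply/funext => y; apply: big1 => a ra.
  have [->|ca] := eqVneq (coef P a p) 0; first by rewrite mul0r.
  by case: na; exists a.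
case: (@arg_maxnP _ a1 (fun a => coef P a p != 0) (fun a => wt (idxword a)) ca1).
move=> a0 ca0 max_a0; exists a0; split=> //.
apply/eqP; rewrite eqn_leq size_idxword_le /= leqNgt; apply/negP => a0r.
have := max_a0 _ ca1; rewrite /weight (size_idxword a1) (eqP ra1).
have := digits_lt (m := m) m0 (size_idxword_le a0).
have : (size (idxword a0) * r.+1 ^ m + r.+1 ^ m <= r * r.+1 ^ m)%N.
  by rewrite -mulSnr leq_mul2r a0r orbT.
lia.
Qed.

End Operator.

(** * Corrections of one derivative, of one weight, and their series *)

Section FlatSolution.
Variables (R : realType) (m r : nat) (P : LPDO R m r).
Local Notation E := 'rV[R]_m.
Local Notation wt := (weight r).
Implicit Types (f u : E -> R) (v w : seq 'I_m) (p q x : E).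

Definition tame u := forall w, exists M : R, forall x, `|dword w u x| <= M.

Lemma words_upto k : exists L : seq (seq 'I_m), forall w, (size w <= k)%N -> w \in L.
Proof.
elim: k => [|k [L IH]]; first by exists [:: [::]] => -[].
exists ([::] :: [seq i :: w | i <- enum 'I_m, w <- L]) => -[//|i w] wk.
by rewrite inE /=; apply/allpairsP; exists (i, w); rewrite mem_enum IH.
Qed.

Lemma words_bound (C : seq 'I_m -> R) k :
  exists2 M : R, 0 <= M & forall w, (size w <= k)%N -> `|C w| <= M.
Proof.
have [L PL] := words_upto k; exists (\sum_(w <- L) `|C w|); first exact: sumr_ge0.
by move=> w /PL wL; rewrite (perm_big _ (perm_to_rem wL)) big_cons lerDl sumr_ge0.
Qed.

Hypothesis m_gt0 : (0 < m)%N.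

Lemma solve_one (pts : seq E) p (w0 : seq 'I_m) (c delta : R) :
  p \in pts -> psymbol P p <> (fun=> 0) -> canonical w0 -> 0 < delta ->
  exists h, [/\ smooth h, tame h,
    forall w x, (size w < size w0 + r)%N -> `|dword w h x| <= delta &
    forall q w, q \in pts -> canonical w -> (wt w <= wt w0)%N ->
      dword w (lpdo_apply P h) q = if (q, w) == (p, w0) then c else 0].
Proof.
move=> ppts sp cw0 d0.
have [a0 [ca0 ra0 max0]] := leading_index m_gt0 sp.
(* A word of weight at most [wt w0] has length at most [wt w0], and [P] adds at most r derivatives:
   flatness up to order K at the other points kills all the conditions there. *)
pose K := (wt w0 + r).+1; pose v := w0 ++ idxword a0.
have sv : size v = (size w0 + r)%N by rewrite size_cat ra0.
have [k [C [k0 fam]]] : exists (kappa : R) C, 0 < kappa /\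
    forall e : R, 0 < e <= 1 -> exists u,
    [/\ smooth u, scaled C (size v) e u, leading v kappa p u &
        forall q, flat_upto (count_mem q (flatten (nseq K [seq q <- pts | q != p]))) q u].
  apply: leading_flat_family; apply/negP => /flattenP[s /nseqP[-> _]].
  by rewrite mem_filter eqxx.
have [M M0 CM] := words_bound C (size v).
(* B bounds the multiplier b below whatever e is, since the leading derivative is at least k. This
   allows e to be chosen after B; the [+ 1] in e only keeps the denominator positive. *)
pose B := `|c| / (`|coef P a0 p| * k).
have B0 : 0 <= B by rewrite divr_ge0// mulr_ge0// ltW.
pose e := Num.min 1 (delta / (B * M + 1)).
have BM : 0 < B * M + 1 by rewrite ltr_wpDl// mulr_ge0.
have e01 : 0 < e <= 1 by rewrite lt_min ltr01 divr_gt0//= ge_min lexx.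
have eBM : e * (B * M) <= delta.
  have : e <= delta / (B * M + 1) by rewrite ge_min lexx orbT.
  rewrite ler_pdivlMr// => ed; apply: le_trans ed.
  by case/andP: e01 => e0 _; rewrite ler_wpM2l ?lerDl// ltW.
have [u [su bu lu fu]] := fam e e01; case/andP: e01 => e0 e1.
pose l := dword v u p; have kl : k <= l by apply: lu.2.
have l0 : 0 < l by apply: lt_le_trans kl.
pose b := c / (coef P a0 p * l).
have bB : `|b| <= B.
  rewrite normrM normfV normrM (gtr0_norm l0) ler_wpM2l//.
  by rewrite lef_pV2 ?posrE ?mulr_gt0 ?normr_gt0// ler_wpM2l.
have dw w x : e ^+ size w * `|dword w (cst b * u) x| <= B * `|C w| * e ^+ size v.
  rewrite dwordZ// normrM mulrCA -mulrA. apply: ler_pM => //.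
    by rewrite mulr_ge0// exprn_ge0// ltW.
  apply: le_trans (bu w x) _.
  by rewrite ler_wpM2r ?exprn_ge0 ?ler_norm// ltW.
have e_gt0 n : 0 < e ^+ n by rewrite exprn_gt0.
exists (cst b * u); split.
- by apply: smoothM => //; exact: smooth_cst.
- move=> w; exists (B * `|C w| * e ^+ size v / e ^+ size w) => x.
  by rewrite ler_pdivlMr// mulrC.
- move=> w x; rewrite -sv => wv; apply: le_trans eBM.
  rewrite -(ler_pM2l (e_gt0 (size w))); apply: le_trans (dw w x) _.
  rewrite mulrA -exprSr mulrC.
  apply: ler_pM; [exact: ltW|exact: mulr_ge0| |].
    by rewrite ler_wiXn2l// ltW.
  by rewrite ler_wpM2l// CM// ltnW.
move=> q w qpts cw ww0; rewrite dword_lpdoZ//.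
have [->|qp] := eqVneq q p; last first.
  rewrite xpair_eqE (negPf qp) /= (lpdo_flat _ su (fu q)) ?mulr0//.
  rewrite count_flatten map_nseq sumn_nseq.
  have : (0 < count_mem q [seq q0 <- pts | q0 != p])%N.
    by rewrite -has_count has_pred1 mem_filter qp.
  move=> c0; rewrite (@leq_trans K) ?leq_pmull// ltnS leq_add2r.
  exact: leq_trans (size_le_weight r w) ww0.
rewrite (lpdo_leading m_gt0 ra0 max0 su lu ww0) xpair_eqE eqxx /=.
have [->|ww] := eqVneq w w0.
  by rewrite -/v -/l /b; field; rewrite ca0 gt_eqF.
(* If [w ++ idxword a0] dominated [w0 ++ idxword a0], then w would dominate w0 with no larger
   weight, hence equal it. *)
rewrite lu.1 ?mulr0//; apply: contra ww => /subcountP sub.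
have sub' : subcount w0 w.
  by apply/subcountP => i; have := sub i; rewrite !count_cat leq_add2r.
rewrite eq_sym -canonical_perm//.
by have [h1 <-] := subcount_weight r sub'; rewrite eqn_leq h1.
Qed.

Lemma solve_level (pts : seq E) (n : nat) (c : E -> seq 'I_m -> R) (delta : R) :
  (forall p, p \in pts -> psymbol P p <> (fun=> 0)) -> 0 < delta ->
  exists h, [/\ smooth h, tame h,
    forall w x, (size w < n %/ (2 * r.+1 ^ m))%N -> `|dword w h x| <= delta &
    forall q w, q \in pts -> canonical w -> (wt w <= n)%N ->
      dword w (lpdo_apply P h) q = if wt w == n then c q w else 0].
Proof.
move=> sp; have [L PL] := words_upto n.
(* The conditions of weight n are treated one pair (point, word) at a time: a correction for one
   pair leaves all other pairs of weight at most n unchanged, so the corrections simply add up. *)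
suff main (T : seq (E * seq 'I_m)) : uniq T ->
    (forall t, t \in T -> [/\ t.1 \in pts, canonical t.2 & wt t.2 = n]) ->
    forall delta : R, 0 < delta -> exists h, [/\ smooth h, tame h,
      forall w x, (size w < n %/ (2 * r.+1 ^ m))%N -> `|dword w h x| <= delta &
      forall q w, q \in pts -> canonical w -> (wt w <= n)%N ->
        dword w (lpdo_apply P h) q = if (q, w) \in T then c q w else 0].
  pose T := undup [seq (q, w) | q <- pts, w <- [seq w <- L | canonical w & wt w == n]].
  have memT q w : (q, w) \in T = [&& q \in pts, w \in L, canonical w & wt w == n].
    rewrite mem_undup; apply/allpairsP/idP => [[[q' w'] /= [q1]]|].
      by rewrite mem_filter => /andP[/andP[cw ww] wL] [-> ->]; apply/and4P.
    move=> /and4P[? ? ? ?]; exists (q, w); rewrite mem_filter; split=> //.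
    by apply/andP; split=> //; apply/andP.
  move=> d0.
  have [|h [sh th bh vh]] := main T (undup_uniq _) _ _ d0.
    by case=> q w; rewrite memT => /and4P[? ? ? /eqP].
  exists h; split=> // q w qp cw wn; rewrite vh// memT qp cw /=.
  by rewrite PL// (leq_trans (size_le_weight r w)).
elim: T => [_ _|t T IH /andP[tT uT] PT] d d0.
  exists (cst 0); split=> [|w|w x _|q w _ _ _]; first exact: smooth_cst.
  - by exists 0 => x; rewrite dword_cst; case: ifP; rewrite normr0.
  - by rewrite dword_cst; case: ifP; rewrite normr0 ltW.
  - rewrite in_nil dword_lpdo; last exact: smooth_cst.
    rewrite big1// => a _; rewrite big1// => s _.
    by rewrite dword_cst; case: ifP; rewrite mulr0.
have d2 : 0 < d / 2 by lra.
have [|h [sh th bh vh]] := IH uT _ _ d2.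
  by move=> t' t'T; apply: PT; rewrite inE t'T orbT.
case: t tT PT => p w0 tT PT; have [/= pp cw0 ww0] := PT _ (mem_head _ _).
have [h' [sh' th' bh' vh']] := solve_one (c p w0) pp (sp _ pp) cw0 d2.
exists (h + h'); split; first exact: smoothD.
- move=> w; have [M bM] := th w; have [M' bM'] := th' w; exists (M + M') => x.
  by rewrite dwordD//; apply: le_trans (ler_normD _ _) _; exact: lerD.
- move=> w x wn; rewrite dwordD// [leRHS]splitr.
  apply: le_trans (ler_normD _ _) _; apply: lerD; first exact: bh.
  apply: bh'; rewrite ltn_addr// (leq_trans wn)// -ww0.
  by rewrite (leq_trans (leq_div2r _ (weight_lt_size r w0)))// mulnK// muln_gt0 expn_gt0.
move=> q w qp cw wn; rewrite dword_lpdoD// vh// vh' ?ww0// inE.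
have [e|ne] := eqVneq (q, w) (p, w0); last by rewrite addr0.
by move: e tT => [-> ->] /negPf ->; rewrite add0r.
Qed.

Theorem flat_solution (pts : seq E) (g : E -> R) : smooth g ->
  (forall p, p \in pts -> psymbol P p <> (fun=> 0)) ->
  exists2 f, smooth f & forall p w, p \in pts -> canonical w ->
    dword w (lpdo_apply P f) p = dword w g p.
Proof.
move=> sg sp.
(* The correction of weight n depends on the partial sum S already built, hence a choice function on
   pairs (n, S). *)
have /choice[step stepP] : forall nS : nat * (E -> R), exists h : E -> R,
    [/\ smooth h, tame h,
    forall w x, (size w < nS.1 %/ (2 * r.+1 ^ m))%N -> `|dword w h x| <= 1 / 2 ^+ nS.1 &
    forall q w, q \in pts -> canonical w -> (wt w <= nS.1)%N ->
      dword w (lpdo_apply P h) q = if wt w == nS.1 then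
        dword w g q - dword w (lpdo_apply P nS.2) q else 0].
  move=> [n S] /=.
  apply: (@solve_level pts n (fun q w => dword w g q - dword w (lpdo_apply P S) q)) => //.
pose fix S n : E -> R := if n is k.+1 then S k + step (k, S k) else cst 0.
pose h n := step (n, S n).
have sh n : smooth (h n) by have [] := stepP (n, S n).
have sS n : smooth (S n).
  by elim: n => [|n IH]; [exact: smooth_cst | exact: (smoothD IH (sh n))].
have [F sF cF] : exists2 F, smooth F & forall w x,
    series (fun n => dword w (h n) x) @ \oo --> dword w F x.
  apply: smooth_series => // w.
  (* From n0 on, w is short enough for the bound [1 / 2 ^+ n]; the finitely many earlier terms are
     only bounded, and their bounds go into the constant. *)
  pose n0 := ((size w).+1 * (2 * r.+1 ^ m))%N.
  have /choice[M bM] : forall n, exists M : R, forall x, `|dword w (h n) x| <= M.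
    by move=> n; have [_ /(_ w)] := stepP (n, S n).
  exists (1 + \sum_(n < n0) `|M n| * 2 ^+ n) => n x.
  have p2 k : 0 < 2 ^+ k :> R by rewrite exprn_gt0.
  have ge0 (I : finType) (A : pred I) (F : I -> nat) :
    0 <= \sum_(k | A k) `|M (F k)| * 2 ^+ (F k).
    by apply: sumr_ge0 => k _; rewrite mulr_ge0// ltW.
  rewrite ler_pdivlMr//; have [nn0|n0n] := ltnP n n0.
    rewrite (bigD1 (Ordinal nn0))//= [leRHS]addrCA -[leLHS]addr0 lerD//.
      by rewrite ler_pM2r// (le_trans (bM n x))// ler_norm.
    by rewrite addr_ge0// ge0.
  have [_ _ b _] := stepP (n, S n).
  rewrite -[leLHS]addr0 lerD ?ge0// -ler_pdivlMr// b//=.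
  by rewrite (leq_trans (ltnSn _))// leq_divRL// muln_gt0 expn_gt0.
exists F => // p w pp cw.
have PS n : dword w (lpdo_apply P (S n)) p =
    series (fun k => dword w (lpdo_apply P (h k)) p) n.
  elim: n => [|n IH].
    rewrite /series /= big_nil dword_lpdo; last exact: smooth_cst.
    rewrite big1// => a _; rewrite big1// => s _.
    by rewrite dword_cst; case: ifP; rewrite mulr0.
  by rewrite seriesSr -IH [LHS]dword_lpdoD//; exact: sh.
(* At fixed p, the derivative of [P F] is a finite combination of derivatives of F with coefficients
   independent of n, so it commutes with the limit. *)
have cvP : series (fun k => dword w (lpdo_apply P (h k)) p) @ \oo -->
    dword w (lpdo_apply P F) p.
  rewrite dword_lpdo//.
  rewrite (_ : series _ = fun n => \sum_(a : mindex m r) \sum_(s <- splits w)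
    dword s.1 (coef P a) p *
    series (fun k => dword (s.2 ++ idxword a) (h k) p) n); last first.
    apply/funext => n; rewrite /series /=.
    under eq_bigr do rewrite dword_lpdo//.
    rewrite exchange_big; apply: eq_bigr => a _ /=.
    by rewrite exchange_big; apply: eq_bigr => s _; rewrite mulr_sumr.
  apply: (cvg_big add_continuous) => a _; apply: (cvg_big add_continuous) => s _.
  by apply: cvgM; [exact: cvg_cst|exact: cF].
(* Step n installs the right derivatives of weight n and keeps those of smaller weight, so the
   sequence is eventually constant. *)
have Sw n : (wt w < n)%N -> dword w (lpdo_apply P (S n)) p = dword w g p.
  elim: n => // n IH; rewrite ltnS leq_eqVlt => /predU1P[wn|wn].
    rewrite [LHS]dword_lpdoD//; last exact: sh.
    have [_ _ _ ->] := stepP (n, S n); rewrite ?wn//=.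
    by rewrite -wn eqxx addrC subrK.
  rewrite [LHS]dword_lpdoD//; last exact: sh.
  have [_ _ _ ->] := stepP (n, S n); rewrite ?(ltnW wn)//=.
  by rewrite ltn_eqF// addr0 IH.
apply: (@cvg_unique _ _ (series (fun k => dword w (lpdo_apply P (h k)) p) @ \oo)) => //.
apply: cvg_near_cst; near=> n; rewrite -PS Sw//; near: n; exact: nbhs_infty_gt.
Unshelve. all: by end_near. Qed.

End FlatSolution.

(** * Superstructures and transfer *)

Section Superstructures.
Variables (X : Type) (V : superstructure X).
Implicit Types (a b c : V) (A : set V) (n : nat).

Definition rank_in n : set V := rank_le (@elem X V) (range (@atom X V)) n.

Lemma rank_inW n k : (n <= k)%N -> rank_in n `<=` rank_in k.
Proof.
move=> /subnKC <-; elim: (k - n)%N => [|i IH] a an; rewrite ?addn0 ?addnS//.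
by left; exact: IH.
Qed.

Lemma vsetP n A : A `<=` rank_in n ->
  is_vset (vset A) /\ forall c, elem c (vset A) <-> A c.
Proof. by move=> /comprehension; exact: getPex. Qed.

Lemma elem_vset n A c : A `<=` rank_in n -> elem c (vset A) <-> A c.
Proof. by move=> /vsetP[_]. Qed.

Lemma rank_vset n A : A `<=` rank_in n -> rank_in n.+1 (vset A).
Proof. by move=> An; have [sA eA] := vsetP An; right; split=> // c /eA/An. Qed.

Lemma elem_is_vset a c : elem c a -> is_vset a.
Proof. by move=> ca [x _ e]; apply: (@elem_atom _ V c x); rewrite e. Qed.

Lemma rank2 a b : exists n, rank_in n a /\ rank_in n b.
Proof.
have [i ia] := finite_rank a; have [j jb] := finite_rank b.
exists (maxn i j); split; [apply: rank_inW ia|apply: rank_inW jb].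
  exact: leq_maxl.
exact: leq_maxr.
Qed.

Lemma elem_vset1 a c : elem c (vset [set a]) <-> c = a.
Proof.
by have [n an] := finite_rank a; apply: (@elem_vset n) => _ ->.
Qed.

Lemma elem_vset2 a b c : elem c (vset [set a; b]) <-> c = a \/ c = b.
Proof.
by have [n [an bn]] := rank2 a b; apply: (@elem_vset n) => _ [->|->].
Qed.

Lemma elem_vpair a b c : elem c (vpair a b) <-> c = vset [set a] \/ c = vset [set a; b].
Proof. exact: elem_vset2. Qed.

Lemma vset1E a c : (elem a c /\ forall d, elem d c -> d = a) -> c = vset [set a].
Proof.
move=> [ac ca]; apply: elem_ext; first exact: elem_is_vset ac.
  by apply: (@elem_is_vset _ a); apply/elem_vset1.
by move=> d; split=> [/ca ->|/elem_vset1 ->//]; apply/elem_vset1.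
Qed.

Lemma vset2E a b c : (elem a c /\ elem b c /\ forall d, elem d c -> d = a \/ d = b) ->
  c = vset [set a; b].
Proof.
move=> [ac [bc cab]]; apply: elem_ext; first exact: elem_is_vset ac.
  by apply: (@elem_is_vset _ a); apply/elem_vset2; left.
by move=> d; split=> [/cab|/elem_vset2[->|->]//] ; move=> ?; apply/elem_vset2.
Qed.

Lemma vset1_inj a b : vset [set a] = vset [set b] -> a = b.
Proof. by move=> e; apply/elem_vset1; rewrite -e; apply/elem_vset1. Qed.

Lemma vpair_inj a b a' b' : vpair a b = vpair a' b' -> a = a' /\ b = b'.
Proof.
move=> e.
have e1 : elem (vset [set a]) (vpair a' b') by rewrite -e; apply/elem_vpair; left.
have e2 : elem (vset [set a; b]) (vpair a' b') by rewrite -e; apply/elem_vpair; right.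
have e3 : elem (vset [set a'; b']) (vpair a b) by rewrite e; apply/elem_vpair; right.
have aa' : a = a'.
  move: e1 => /elem_vpair[/vset1_inj//|ea]; apply/esym/elem_vset1.
  by rewrite ea; apply/elem_vset2; left.
subst a'; split=> //.
have b2 : elem b (vset [set a; b]) by apply/elem_vset2; right.
have b2' : elem b' (vset [set a; b']) by apply/elem_vset2; right.
move: e2 => /elem_vpair[ea|ea]; last first.
  move: (b2); rewrite ea => /elem_vset2[ba|//].
  by move: b2'; rewrite -ea => /elem_vset2[->|->].
move: b2; rewrite ea => /elem_vset1 ba.
move: e3 => /elem_vpair[eb|eb]; move: b2'; rewrite eb.
  by move=> /elem_vset1 ->.
by move=> /elem_vset2[->|->].
Qed.

Lemma rank_vpair n a b : rank_in n a -> rank_in n b -> rank_in n.+2 (vpair a b).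
Proof.
move=> an bn; apply: rank_vset => _ [->|->]; apply: rank_vset => c.
  by move=> ->.
by move=> [->|->].
Qed.

Section Graphs.
Variables (T : Type) (dom val : T -> V) (n : nat).
Hypotheses (dom_n : forall t, rank_in n (dom t)) (val_n : forall t, rank_in n (val t)).

Let graph_n : range (fun t => vpair (dom t) (val t)) `<=` rank_in n.+2.
Proof. by move=> _ [t _ <-]; exact: rank_vpair. Qed.

Lemma rank_vgraph : rank_in n.+3 (vgraph dom val).
Proof. exact: rank_vset. Qed.

Lemma elem_vgraph c : elem c (vgraph dom val) <-> exists t, c = vpair (dom t) (val t).
Proof.
rewrite (elem_vset _ graph_n); split=> [[t _ <-]|[t ->]]; first by exists t.
by exists t.
Qed.

Lemma vpair_vgraph a b :
  elem (vpair a b) (vgraph dom val) <-> exists t, a = dom t /\ b = val t.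
Proof.
by rewrite elem_vgraph; split=> [[t /vpair_inj e]|[t [-> ->]]]; exists t.
Qed.

End Graphs.

Lemma vgraph_inj (T : Type) (dom val val' : T -> V) n :
  (forall t, rank_in n (dom t)) -> (forall t, rank_in n (val t)) ->
  (forall t, rank_in n (val' t)) -> injective dom ->
  vgraph dom val = vgraph dom val' -> val =1 val'.
Proof.
move=> dn vn vn' di e t.
have : elem (vpair (dom t) (val t)) (vgraph dom val').
  by rewrite -e; apply/(vpair_vgraph dn vn); exists t.
by move=> /(vpair_vgraph dn vn')[t' [/di <-]].
Qed.

Definition functional (F : V) := forall a b b',
  elem (vpair a b) F -> elem (vpair a b') F -> b = b'.

Lemma vapp_eq F a b : functional F -> elem (vpair a b) F -> vapp F a = b.
Proof.
by move=> fF ab; apply: fF (ab); apply: (@getPex _ [set b | elem (vpair a b) F]); exists b.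
Qed.

Lemma functional_vgraph (T : Type) (dom val : T -> V) n :
  (forall t, rank_in n (dom t)) -> (forall t, rank_in n (val t)) ->
  (forall t t', dom t = dom t' -> val t = val t') -> functional (vgraph dom val).
Proof.
move=> dn vn dv a b b' /(vpair_vgraph dn vn)[t [-> ->]].
by move=> /(vpair_vgraph dn vn)[t' [/dv e ->]].
Qed.

Definition fsing (z a : nat) := BAnd (BElem a z) (BAll z (BEq 0 a.+1)).

Definition fupair (z a b : nat) :=
  BAnd (BElem a z) (BAnd (BElem b z) (BAll z (BOr (BEq 0 a.+1) (BEq 0 b.+1)))).

Definition fpair (z a b : nat) :=
  BAnd (BEx z (fsing 0 a.+1)) (BAnd (BEx z (fupair 0 a.+1 b.+1))
    (BAll z (BOr (fsing 0 a.+1) (fupair 0 a.+1 b.+1)))).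

Definition fpair_in (F a b : nat) := BEx F (fpair 0 a.+1 b.+1).

(* The bound variables are, from the outside in, the pair (((k, x), h), j), an
   element of it containing ((k, x), h), then ((k, x), h), an element of it
   containing (k, x), and (k, x). *)
Definition ftuple4_in (F k x h j : nat) :=
  BEx F (BEx 0 (BEx 0 (BEx 0 (BEx 0
    (BAnd (fpair 0 k.+4.+1 x.+4.+1) (BAnd (fpair 2 0 h.+4.+1) (fpair 4 2 j.+4.+1))))))).

Lemma fsingP (rho : nat -> V) (z a : nat) :
  bholds rho (fsing z a) <-> rho z = vset [set rho a].
Proof.
split; first exact: vset1E.
by move=> /= ->; split=> [|x /elem_vset1 //]; apply/elem_vset1.
Qed.

Lemma fupairP (rho : nat -> V) (z a b : nat) :
  bholds rho (fupair z a b) <-> rho z = vset [set rho a; rho b].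
Proof.
split; first exact: vset2E.
by move=> /= ->; split; [|split=> [|x /elem_vset2 //]]; apply/elem_vset2; [left|right].
Qed.

Lemma fpairP (rho : nat -> V) (z a b : nat) :
  bholds rho (fpair z a b) <-> rho z = vpair (rho a) (rho b).
Proof.
split=> [[[s [sz /fsingP es]] [[t [tz /fupairP et]] zst]]|e].
  apply: vset2E; split; first by move: es sz => /= ->.
  split; first by move: et tz => /= ->.
  by move=> d /zst [/fsingP|/fupairP] /= ->; [left|right].
split.
  exists (vset [set rho a]); split; last exact/fsingP.
  by rewrite e; apply/elem_vpair; left.
split.
  exists (vset [set rho a; rho b]); split; last exact/fupairP.
  by rewrite e; apply/elem_vpair; right.
move=> d; rewrite e => /elem_vpair[] ->; [left|right].
  exact/fsingP.
exact/fupairP.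
Qed.

Lemma fpair_inP (rho : nat -> V) (F a b : nat) :
  bholds rho (fpair_in F a b) <-> elem (vpair (rho a) (rho b)) (rho F).
Proof.
split=> [[z [zF /fpairP /= <-//]]|abF].
by exists (vpair (rho a) (rho b)); split=> //; exact/fpairP.
Qed.

Lemma ftuple4_inP (rho : nat -> V) (F k x h j : nat) : bholds rho (ftuple4_in F k x h j) <->
  elem (vpair (vpair (vpair (rho k) (rho x)) (rho h)) (rho j)) (rho F).
Proof.
split.
  case=> z [zF [c [_ [q [_ [d [_ [s [_ [/fpairP es [/fpairP eq /fpairP ez]]]]]]]]]]].
  by move: es eq ez zF => /= -> -> ->.
set s := vpair (rho k) (rho x); set q := vpair s (rho h); set z := vpair q _ => zF.
exists z; split=> //; exists (vset [set q]); split; first by apply/elem_vpair; left.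
exists q; split; first exact/elem_vset1.
exists (vset [set s]); split; first by apply/elem_vpair; left.
exists s; split; first exact/elem_vset1.
by split; [exact/fpairP|split; exact/fpairP].
Qed.

End Superstructures.

Arguments fpair : simpl never.
Arguments fpair_in : simpl never.
Arguments ftuple4_in : simpl never.

Section Transfer.
Variables (X Y : Type) (V : superstructure X) (W : superstructure Y).
Variable (star : nsextension V W).

Lemma elem_vpairs (U : superstructure Y) (a b : U) :
  elem (vset [set a; b]) (vpair a b) /\
  (elem a (vset [set a; b]) /\ elem b (vset [set a; b])).
Proof.
by split; [apply/elem_vpair; right|split; apply/elem_vset2; [left|right]].
Qed.

Lemma star_functional (F : V) : functional F -> functional (star F).
Proof.
move=> fF a b b'.
(* Quantifiers must be bounded: x, y and y' are reached as members of members c, c' of the pairs p,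
   p' in F. *)
pose phi := BAll 0 (BAll 1 (BAll 1 (BAll 1 (BAll 1 (BAll 2 (BAll 2
  (BImp (fpair 6 2 1) (BImp (fpair 5 2 0) (BEq 1 0))))))))).
have /(transfer star) H : bholds (fun=> F) phi.
  move=> p pF p' p'F c _ c' _ x _ y _ y' _ /fpairP e /fpairP e'.
  by move: pF p'F e e' => /= pF p'F e e'; subst; exact: fF pF p'F.
move=> abF ab'F; have [p1 [p2 p3]] := elem_vpairs a b.
have [p1' [_ p3']] := elem_vpairs a b'.
by apply: (H _ abF _ ab'F _ p1 _ p1' _ p2 _ p3 _ p3'); exact/fpairP.
Qed.

End Transfer.

(** * Codes of points, functions, jets and of the solution relation *)

Section CodeFacts.
Variables (R : realType) (X : Type) (iota : R -> X) (iota_inj : injective iota).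
Variables (V : superstructure X) (m : nat).
Local Notation E := 'rV[R]_m.
Local Notation rank_in := (@rank_in X V).

Lemma vreal_inj : injective (vreal iota V).
Proof. by move=> s t e; exact: iota_inj (atom_inj e). Qed.

Lemma vnat_inj : injective (vnat iota V).
Proof. by move=> s t /vreal_inj/eqP; rewrite eqr_nat => /eqP. Qed.

Lemma rank_vreal n t : rank_in n (vreal iota V t).
Proof. by apply: (@rank_inW _ _ 0%N) => //; exists (iota t). Qed.

Lemma rank_vtuple k (a : 'I_k -> V) : (forall i, rank_in 0 (a i)) ->
  rank_in 3 (vtuple iota a).
Proof. by move=> a0; apply: rank_vgraph => // i; exact: rank_vreal. Qed.

Lemma rank_vpoint (x : E) : rank_in 3 (vpoint iota V x).
Proof. by apply: rank_vtuple => i; exact: rank_vreal. Qed.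

Lemma vpoint_inj : injective (@vpoint R X iota V m).
Proof.
move=> x y e; apply/rowP => i; apply: vreal_inj.
apply: (@vgraph_inj _ V _ (fun i : 'I_m => vnat iota V i) _ _ 0%N) e i => i;
  try exact: rank_vreal.
by move=> j /vnat_inj /val_inj.
Qed.

Lemma rank_vfunction (f : E -> R) : rank_in 6 (vfunction iota V f).
Proof. by apply: rank_vgraph => x; [exact: rank_vpoint|exact: rank_vreal]. Qed.

Lemma vfunction_inj (f g : E -> R) : vfunction iota V f = vfunction iota V g -> f = g.
Proof.
move=> e; apply/funext => x; apply: vreal_inj.
apply: (@vgraph_inj _ V _ (@vpoint R X iota V m) _ _ 3%N) e x => x;
  try exact: rank_vreal; try exact: rank_vpoint.
by move=> y /vpoint_inj.
Qed.

Lemma rank_vjet k (u : {ffun mindex m k -> R}) : rank_in 6 (vjet iota V u).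
Proof.
by apply: rank_vgraph => a; [apply: rank_vtuple => i|]; exact: rank_vreal.
Qed.

Lemma elem_vCinf c : elem c (vCinf iota V m) <-> exists f : Cinf R m, c = vfunction iota V f.
Proof.
rewrite (@elem_vset _ _ 6); last by move=> _ [f _ <-]; exact: rank_vfunction.
by split=> [[f _ <-]|[f ->]]; exists f.
Qed.

Lemma elem_vNat c : elem c (vNat iota V) <-> exists k, c = vnat iota V k.
Proof.
rewrite (@elem_vset _ _ 0); last by move=> _ [f _ <-]; exact: rank_vreal.
by split=> [[f _ <-]|[f ->]]; exists f.
Qed.

Let rank_jet_dom (t : nat * E * Cinf R m) : rank_in 8
  (vpair (vpair (vnat iota V t.1.1) (vpoint iota V t.1.2)) (vfunction iota V t.2)).
Proof.
apply: rank_vpair; last exact: rank_vfunction.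
apply: (@rank_inW _ _ 5) => //; apply: rank_vpair; first exact: rank_vreal.
exact: rank_vpoint.
Qed.

Let rank_jet_val (t : nat * E * Cinf R m) : rank_in 8 (vjet iota V (jet t.1.1 t.1.2 t.2)).
Proof. by apply: (@rank_inW _ _ 6) => //; exact: rank_vjet. Qed.

Lemma elem_vjetmap k x (f : Cinf R m) : elem
  (vpair (vpair (vpair (vnat iota V k) (vpoint iota V x)) (vfunction iota V f))
     (vjet iota V (jet k x f))) (vjetmap iota V m).
Proof. by apply/(vpair_vgraph rank_jet_dom rank_jet_val); exists (k, x, f). Qed.

Lemma functional_vjetmap : functional (vjetmap iota V m).
Proof.
apply: (functional_vgraph rank_jet_dom rank_jet_val).
move=> [[k x] f] [[k' x'] f'] /= /vpair_inj[/vpair_inj[/vnat_inj -> /vpoint_inj ->]].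
by move=> /vfunction_inj ->.
Qed.

Variables (r : nat) (P : LPDO R m r).

Lemma elem_vlpdo (f : Cinf R m) :
  elem (vpair (vfunction iota V f) (vfunction iota V (lpdo_apply P f))) (vlpdo iota V P).
Proof.
by apply/(vpair_vgraph (n := 6)); [move=> ?|move=> ?|exists f]; try exact: rank_vfunction.
Qed.

Lemma functional_vlpdo : functional (vlpdo iota V P).
Proof.
apply: (@functional_vgraph _ _ _ _ _ 6) => [f|f|f g]; try exact: rank_vfunction.
by move=> /vfunction_inj ->.
Qed.

Definition solves (A : set E) (g f : Cinf R m) :=
  forall p, A p -> forall k, jet k p (lpdo_apply P f) = jet k p g.

(** As a single standard parameter, this relation can be transferred without spelling out
    derivatives in a formula. *)
Definition vsolves (A : set E) : V := vset [set z | exists g f : Cinf R m,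
  solves A g f /\ z = vpair (vfunction iota V g) (vfunction iota V f)].

Lemma elem_vsolves A z : elem z (vsolves A) <-> exists g f : Cinf R m,
  solves A g f /\ z = vpair (vfunction iota V g) (vfunction iota V f).
Proof.
apply: (@elem_vset _ _ 8) => _ [g [f [_ ->]]].
by apply: rank_vpair; exact: rank_vfunction.
Qed.

Lemma vpair_vsolves A (g f : Cinf R m) :
  elem (vpair (vfunction iota V g) (vfunction iota V f)) (vsolves A) <-> solves A g f.
Proof.
rewrite elem_vsolves; split=> [[g' [f' [s /vpair_inj[/vfunction_inj e /vfunction_inj e']]]]|s].
  by move=> p Ap k; rewrite e' e; exact: s.
by exists g, f.
Qed.

(** Bounds the quantifier over sets of solutions; members of its star-image are internal by
    definition. *)
Definition vpower (B : V) : V := vset [set a | is_vset a /\ forall c, elem c a -> elem c B].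

Lemma elem_vpower a : elem a (vpower (vCinf iota V m)) <->
  is_vset a /\ forall c, elem c a -> elem c (vCinf iota V m).
Proof.
apply: (@elem_vset _ _ 7) => b [sb bC]; right; split=> // c /bC /elem_vCinf[f ->].
exact: rank_vfunction.
Qed.

Lemma elem_vbase c : elem c (vbase V) <-> range (@atom X V) c.
Proof. by apply: (@elem_vset _ _ 0). Qed.

End CodeFacts.

(** * Transfer of solvability, and saturation *)

Section Main.
Variables (R : realType) (X Y : Type) (iota : R -> X) (iota_inj : injective iota).
Variables (V : superstructure X) (W : superstructure Y) (star : nsextension V W).
Variables (m r : nat) (m_ge1 : (1 <= m)%N) (P : LPDO R m r).
Hypothesis symb_neq0 : forall x : 'rV[R]_m, psymbol P x <> (fun=> 0).
Local Notation E := 'rV[R]_m.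
Local Notation C := (vCinf iota V m).
Local Notation S := (vsolves iota V P).

Lemma solvable (pts : seq E) (g : Cinf R m) :
  exists f, solves P [set` pts] g f.
Proof.
have [|f sf ef] := flat_solution m_ge1 (pts := pts) (Cinf_smooth g) (P := P).
  by move=> p _; exact: symb_neq0.
exists (MkCinf sf) => p pp k; apply/ffunP => a; rewrite !ffunE !mpderivE.
by apply: ef => //; exact: canonical_idxword.
Qed.

Lemma star_solvable (pts : seq E) g : elem g (star C) ->
  exists2 f, elem f (star C) & elem (vpair g f) (star (S [set` pts])).
Proof.
pose phi := BAll 0 (BEx 1 (fpair_in 3 1 0)).
have /(transfer star) H : bholds (push C (fun=> S [set` pts])) phi.
  move=> _ /elem_vCinf[g' ->]; have [f s] := solvable pts g'.
  exists (vfunction iota V f); split; first by apply/elem_vCinf; exists f.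
  by apply/fpair_inP/vpair_vsolves.
by move=> /H[f [fC /fpair_inP gf]]; exists f.
Qed.

Lemma star_vsolves_mono (A B : set E) z : B `<=` A ->
  elem z (star (S A)) -> elem z (star (S B)).
Proof.
move=> BA; have /(transfer star) H : bholds (push (S A) (fun=> S B)) (BAll 0 (BElem 0 2)).
  move=> _ /elem_vsolves[g [f [s ->]]]; apply/vpair_vsolves => // p Bp.
  by apply: s; exact: BA.
exact: H.
Qed.

(** For g internal but not standard, the set of its solutions is not the star-image of a standard
    set. Transferring the existence of all slices of the standard relation yields it as an internal
    set, to which saturation applies. *)
Lemma star_slice (A : set E) g : elem g (star C) ->
  exists e, [/\ internal star e, is_vset e, forall f, elem f e -> elem f (star C) &
    forall f, elem f (star C) -> elem f e <-> elem (vpair g f) (star (S A))].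
Proof.
pose Pw := vpower C.
have /(transfer star) H1 : bholds (push C (push Pw (fun=> S A)))
    (BAll 0 (BEx 2 (BAll 2 (BAnd (BImp (BElem 0 1) (fpair_in 5 2 0))
                                 (BImp (fpair_in 5 2 0) (BElem 0 1)))))).
  move=> _ /elem_vCinf[g' ->].
  pose B : set V := [set c | exists2 f : Cinf R m, solves P A g' f & c = vfunction iota V f].
  have [sB eB] : is_vset (vset B) /\ forall c, elem c (vset B) <-> B c.
    by apply: (@vsetP _ _ 6) => _ [f _ ->]; exact: rank_vfunction.
  exists (vset B); split.
    by apply/elem_vpower; split=> // c /eB[f _ ->]; apply/elem_vCinf; exists f.
  move=> _ /elem_vCinf[f ->]; split.
    move=> /eB[f' s /(vfunction_inj iota_inj) e]; apply/fpair_inP/vpair_vsolves => //.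
    by move=> p Ap k; rewrite e; exact: s.
  by move=> /fpair_inP/(vpair_vsolves iota_inj) s; apply/eB; exists f.
(* Being a set, not an atom, is expressed by not belonging to [vbase V], whose star-image is
   [vbase W]. *)
have /(transfer star) H2 : bholds (push Pw (push C (fun=> vbase V)))
    (BAll 0 (BAnd (BNot (BElem 0 3)) (BAll 0 (BElem 0 3)))).
  by move=> e /elem_vpower[se eC]; split; [move=> /elem_vbase|].
move=> /H1[e [eP He]]; have [se eC] := H2 e eP.
exists e; split=> //; first by exists Pw.
  by move=> ate; apply: se; rewrite /= star_base; apply/elem_vbase.
by move=> f /He[h1 h2]; split=> [/h1/fpair_inP|h] //; apply: h2; apply/fpair_inP.
Qed.

Lemma star_jets_agree (x : E) g f : elem g (star C) -> elem f (star C) ->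
  elem (vpair g f) (star (S [set x])) ->
  star_jinf iota star m (star (vpoint iota V x)) (vapp (star (vlpdo iota V P)) f) =
  star_jinf iota star m (star (vpoint iota V x)) g.
Proof.
pose J := vjetmap iota V m.
(* The common jet j is bounded by searching it inside a pair z of the jet map; k ranges over all of
   N, hence over *N after transfer. Both graphs stay functional, which turns membership into values
   of [vapp]. *)
have /(transfer star) H : bholds
    (push C (push (S [set x]) (push (vlpdo iota V P) (push (vNat iota V)
      (push J (fun=> vpoint iota V x))))))
    (BAll 0 (BAll 1 (BImp (fpair_in 3 1 0)
      (BEx 2 (BAnd (fpair_in 5 1 0)
        (BAll 6 (BEx 8 (BEx 0 (BEx 0
          (BAnd (ftuple4_in 11 3 12 4 0) (ftuple4_in 11 3 12 6 0))))))))))).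
  move=> _ /elem_vCinf[g' ->] _ /elem_vCinf[f' ->] /fpair_inP/(vpair_vsolves iota_inj) s.
  pose h : Cinf R m := MkCinf (smooth_lpdo P (Cinf_smooth f')).
  exists (vfunction iota V h); split; first by apply/elem_vCinf; exists h.
  split; first by apply/fpair_inP; exact: elem_vlpdo.
  move=> _ /elem_vNat[k ->].
  have hJ := elem_vjetmap iota V k x h; have gJ := elem_vjetmap iota V k x g'.
  rewrite (s x erefl k : jet k x h = _) in hJ.
  eexists; split; first exact: gJ.
  eexists; split; first by apply/elem_vpair; right.
  exists (vjet iota V (jet k x g')); split; first by apply/elem_vset2; right.
  by split; apply/ftuple4_inP; [exact: hJ|exact: gJ].
move=> gC fC gf.
have [|h [hC [/fpair_inP fh Hk]]] := H g gC f fC; first exact/fpair_inP.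
have -> : vapp (star (vlpdo iota V P)) f = h.
  by apply: vapp_eq fh; apply: star_functional; exact: functional_vlpdo.
have fJ : functional (star J) by apply: star_functional; exact: functional_vjetmap.
apply/seteqP; split=> -[k j] [/= kN ->]; split=> //=;
  have [z [_ [c [_ [i [_ [/ftuple4_inP e1 /ftuple4_inP e2]]]]]]] := Hk k kN;
  by rewrite (vapp_eq fJ e1) (vapp_eq fJ e2).
Qed.

End Main.

Theorem corollary5p3 (R : realType) (X Y : Type)
    (iota : R -> X) (iota_inj : injective iota)
    (V : superstructure X) (W : superstructure Y) (star : nsextension V W)
    (star_poly : polysaturated star)
    (m r : nat) (m_ge1 : (1 <= m)%N) (P : LPDO R m r)
    (symb_neq0 : forall x : 'rV[R]_m, psymbol P x <> (fun=> 0)) :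
  forall g : W, elem g (star (vCinf iota V m)) ->
  exists f : W, elem f (star (vCinf iota V m)) /\
    forall x : 'rV[R]_m,
      star_jinf iota star m (star (vpoint iota V x))
                (vapp (star (vlpdo iota V P)) f) =
      star_jinf iota star m (star (vpoint iota V x)) g.
Proof.
move=> g gC; have [K [KV sat]] := star_poly.
have /choice[e eP] x := star_slice iota_inj P [set x] gC.
have [f fe] : exists f, forall A, range e A -> elem f A.
  apply: sat.
  - by move=> _ [x _ <-]; have [] := eP x.
  (* The family is indexed by R^m, which injects into [V] through [vpoint], so K cannot embed into
     it. *)
  - apply: contra_not KV => /card_le_trans; apply.
    apply: (card_le_trans (card_image_le e setT)).
    by apply/pcard_injP; exists (@vpoint R X iota V m) => x y _ _; exact: vpoint_inj.
  - move=> G /finite_seqP[s ->] sG.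
    have [pts ePts] : exists pts : seq 'rV[R]_m, forall A, A \in s ->
        exists2 x, x \in pts & e x = A.
      elim: s sG => [_|A s IH sG]; first by exists [::].
      have [B /= Bs|pts ePts] := IH; first by apply: sG; rewrite /= inE Bs orbT.
      have [x _ exA] := sG A (mem_head _ _).
      exists (x :: pts) => B; rewrite inE => /predU1P[->|/ePts[y yp ey]].
        by exists x; rewrite ?mem_head.
      by exists y => //; rewrite inE yp orbT.
    have [f fC gf] := star_solvable iota_inj m_ge1 symb_neq0 pts gC.
    exists f => A /ePts[x xp <-]; have [_ _ _ exf] := eP x.
    by apply/exf => //; apply: star_vsolves_mono gf => // y ->.
(* Every slice lies in the internal smooth functions, so the one at the origin already shows that f
   is one. *)
have fC : elem f (star (vCinf iota V m)).
  by have [_ _ eC _] := eP 0; apply: eC; apply: fe; exists 0.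
exists f; split=> // x; apply: star_jets_agree => //.
by have [_ _ _ exf] := eP x; apply/exf => //; apply: fe; exists x.
Qed.
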